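(* Let $\mathbb{H}^n$ ($n\ge2$) be the $n$-dimensional hyperbolic space, let $0\le\beta<n$, let $n\le q<\infty$ and $1/q+1/q'=1$. There exists a constant $C_2=C_2(n,\beta,q)>0$ such that $$\left\|\frac{f}{\rho^{\beta/q}}\right\|_{L^q(\mathbb{H}^n)}\le C_2\,q^{1-1/n}\,\|\nabla_g f\|_{L^n(\mathbb{H}^n)}\quad\text{for all } f\in W^{1,n}_0(\mathbb{H}^n),$$ and for any such constant $C_2$ one has $$\left(\int_{\mathbb{H}^n}|\nabla_g f|^n\,dV_g\right)^{1/n}\left(\int_{\mathbb{H}^n}\rho^{q'}|f|^{q'}\,dV_g\right)^{1/q'}\ \ge\ C_2^{-1}q^{1/n-1}\int_{\mathbb{H}^n}\rho^{\frac{q-\beta}{q}}|f|^2\,dV_g$$ for all $f\in W^{1,n}_0(\mathbb{H}^n)$.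
   Context: $\mathbb{H}^n$ is the Poincaré ball model: the unit ball of $\mathbb{R}^n$ with metric $ds^2=4\sum_i dx_i^2/(1-|x|^2)^2$, volume form $dV_g=2^n(1-|x|^2)^{-n}dx$, and $\rho(x)=\ln\frac{1+|x|}{1-|x|}$ the hyperbolic distance to the origin. $\nabla_g$ is the Riemannian gradient, $|\nabla_g f|$ its Riemannian length, and $L^q(\mathbb{H}^n)$ is taken with respect to $dV_g$. $W^{1,n}_0(\mathbb{H}^n)$ is the completion of $C_0^\infty(\mathbb{H}^n)$ in the norm $\left(\int_{\mathbb{H}^n}(|\nabla_g f|^n+|f|^n)\,dV_g\right)^{1/n}$. Integrals may take the value $+\infty$. *)

(* Defs.v *)
From HB Require Import structures.
From mathcomp Require Export all_boot all_order all_algebra.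
From mathcomp Require Export all_classical all_reals all_analysis.
From mathcomp Require Export measurable_realfun.
From mathcomp Require Import ring.
Export Order.TTheory GRing.Theory Num.Theory.
Export numFieldNormedType.Exports.

Set Implicit Arguments.
Unset Strict Implicit.
Unset Printing Implicit Defensive.

Local Open Scope classical_set_scope.
Local Open Scope ring_scope.

(* 'rV[R]_n stands for R^n.  It carries the product Borel sigma-algebra,
   generated by the coordinates (as for n.-tuple in the library). *)
Section measurable_row.
Context {R : realType} {n : nat}.

Let coord (i : 'I_n) (x : 'rV[R]_n) : measurableTypeR R := x ord0 i.

Let row_set0 : g_sigma_preimage coord set0.
Proof. exact: sigma_algebra0. Qed.

Let row_setC A : g_sigma_preimage coord A -> g_sigma_preimage coord (~` A).
Proof. exact: sigma_algebraC. Qed.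

Let row_bigcup (F : (set 'rV[R]_n)^nat) :
  (forall i, g_sigma_preimage coord (F i)) ->
  g_sigma_preimage coord (\bigcup_i (F i)).
Proof. exact: sigma_algebra_bigcup. Qed.

HB.instance Definition _ := @isMeasurable.Build default_measure_display
  'rV[R]_n (g_sigma_preimage coord) row_set0 row_setC row_bigcup.

Lemma measurable_coord (i : 'I_n) :
  measurable_fun [set: 'rV[R]_n] (fun x => x ord0 i).
Proof.
move=> _ Y mY; rewrite setTI; apply: sub_sigma_algebra => /=.
rewrite -bigcup_seq/=; exists i => /=; first by rewrite mem_index_enum.
by exists Y => //; rewrite setTI.
Qed.

Lemma measurable_fun_rowP d (T : measurableType d) (f : T -> 'rV[R]_n) :
  measurable_fun [set: T] f <->
  forall i, measurable_fun [set: T] (fun t => f t ord0 i).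
Proof.
split=> [mf i|mf].
  by apply: (measurableT_comp (measurable_coord i)).
have -> : f = idfun \o f by [].
rewrite /measurable_fun => _ A mA; rewrite setTI.
pose G := [set B | measurable (f @^-1` B)].
suff : (measurable : set (set 'rV[R]_n)) `<=` G by exact.
apply: smallest_sub.
  split; rewrite /G /=.
  - by rewrite preimage_set0.
  - by move=> B mB; rewrite setTD -preimage_setC; exact: measurableC.
  - by move=> F mF; rewrite preimage_bigcup; exact: bigcupT_measurable.
move=> B; rewrite -bigcup_seq => -[i _ [C mC <-]].
by rewrite /G /= setTI; have := mf i measurableT C mC; rewrite setTI.
Qed.

End measurable_row.

Section lebesgue_row.
Context {R : realType}.

Definition row_cons n (p : measurableTypeR R * 'rV[R]_n) : 'rV[R]_n.+1 :=
  row_mx p.1%:M p.2.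

Definition row_uncons n (x : 'rV[R]_n.+1) : measurableTypeR R * 'rV[R]_n :=
  (x ord0 ord0, \row_i x ord0 (lift ord0 i)).

Lemma row_consK n : cancel (@row_cons n) (@row_uncons n).
Proof.
move=> [a v]; rewrite /row_uncons /row_cons /=; congr pair.
  have -> : ord0 = @lshift 1 n ord0 by apply/val_inj.
  by rewrite (row_mxEl a%:M v) mxE eqxx.
apply/rowP => i; rewrite mxE.
have -> : lift ord0 i = @rshift 1 n i by apply/val_inj.
by rewrite (row_mxEr a%:M v).
Qed.

Lemma measurable_row_cons n : measurable_fun setT (@row_cons n).
Proof.
apply/measurable_fun_rowP => i.
have [->|] := eqVneq i ord0.
  rewrite (_ : (fun _ => _) = fst); first exact: measurable_fst.
  by apply/funext => p; exact: (congr1 fst (row_consK p)).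
rewrite eq_sym => /unlift_some[j -> _].
rewrite (_ : (fun _ => _) = (fun v : 'rV[R]_n => v ord0 j) \o snd).
  exact: (measurableT_comp (measurable_coord j) measurable_snd).
by apply/funext => p /=; rewrite -[in RHS](row_consK p) /= mxE.
Qed.

Lemma measurable_row_uncons n : measurable_fun setT (@row_uncons n).
Proof.
apply/measurable_fun_pairP; split; first exact: measurable_coord.
apply/measurable_fun_rowP => i /=.
rewrite (_ : (fun _ => _) = fun x : 'rV[R]_n.+1 => x ord0 (lift ord0 i)).
  exact: measurable_coord.
by apply/funext => x; rewrite /= mxE.
Qed.

Section step.
Variables (n : nat) (mu : {sigma_finite_measure set 'rV[R]_n -> \bar R}).

(* the image of the product of the line measure and mu under
   R x R^n = R^(n+1) *)
Definition row_product : set 'rV[R]_n.+1 -> \bar R :=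
  pushforward (lebesgue_measure \x mu)%E (@row_cons n).

Let row_product0 : row_product set0 = 0%E.
Proof. by rewrite /row_product /pushforward preimage_set0 measure0. Qed.

Let row_product_ge0 A : (0 <= row_product A)%E.
Proof. by rewrite /row_product /pushforward measure_ge0. Qed.

Let row_product_sigma_additive : semi_sigma_additive row_product.
Proof.
move=> F mF tF mUF; rewrite /row_product /pushforward preimage_bigcup.
have mcons B : measurable B -> measurable (@row_cons n @^-1` B).
  by move=> mB; rewrite -[X in measurable X]setTI; exact: measurable_row_cons.
apply: measure_semi_sigma_additive.
- by move=> k; exact: mcons.
- apply/trivIsetP => /= i j _ _ ij; rewrite -preimage_setI.
  by move/trivIsetP : tF => /(_ _ _ _ _ ij) ->//; rewrite preimage_set0.
- by rewrite -preimage_bigcup; exact: mcons.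
Qed.

HB.instance Definition _ := isMeasure.Build _ _ _ row_product
  row_product0 row_product_ge0 row_product_sigma_additive.

Let row_product_sigma_finite : sigma_finite setT row_product.
Proof.
have /sigma_finiteP[F [TF ndF Foo]] := sigma_finiteT (@lebesgue_measure R).
have /sigma_finiteP[G [TG ndG Goo]] := sigma_finiteT mu.
exists (fun k => @row_uncons n @^-1` (F k `*` G k)).
  rewrite -preimage_bigcup -[LHS](preimage_setT (@row_uncons n)); congr (_ @^-1` _).
  rewrite -setXTT TF TG predeqE => -[x y]; split.
    move=> [/= [i _ Fix] [k _ Gky]]; exists (maxn i k) => //; split.
    - by move: x Fix; exact/subsetPset/ndF/leq_maxl.
    - by move: y Gky; exact/subsetPset/ndG/leq_maxr.
  by move=> [k _ []/= ? ?]; split; exists k.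
move=> k; have [mF Fk] := Foo k; have [mG Gk] := Goo k; split.
  rewrite -[X in measurable X]setTI.
  by apply: measurable_row_uncons => //; exact: measurableX.
rewrite /row_product /pushforward -comp_preimage.
rewrite (_ : _ \o _ = idfun); last by apply/funext => p; exact: row_consK.
rewrite preimage_id product_measure1E//.
by rewrite lte_mul_pinfty// ge0_fin_numE.
Qed.

HB.instance Definition _ := Measure_isSigmaFinite.Build _ _ _ row_product
  row_product_sigma_finite.

End step.

(* n-dimensional Lebesgue measure, on Borel sets *)
Fixpoint lebesgue_row (n : nat) :
    {sigma_finite_measure set 'rV[R]_n -> \bar R} :=
  match n with
  | 0%N => @dirac _ 'rV[R]_0 0 R
  | m.+1 => row_product (lebesgue_row m)
  end.

End lebesgue_row.

Section euclidean.
Context {R : realType} {n : nat}.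
Implicit Types (x : 'rV[R]_n) (f : 'rV[R]_n -> R).

(* the library norm `|x| on 'rV_n is the sup norm *)
Definition enorm x : R := Num.sqrt (\sum_i x ord0 i ^+ 2).

Definition unit_ball : set 'rV[R]_n := [set x | enorm x < 1].

Definition partial (i : 'I_n) f : 'rV[R]_n -> R :=
  fun x => 'D_(delta_mx ord0 i) f x.

Definition iter_partial (s : seq 'I_n) f : 'rV[R]_n -> R :=
  foldr partial f s.

Definition smooth f : Prop := forall s : seq 'I_n,
  continuous (iter_partial s f) /\
  forall i x, derivable (iter_partial s f) x (delta_mx ord0 i).

Definition egrad f x : 'rV[R]_n := \row_i partial i f x.

(* C_0^oo of the open unit ball, each function being extended by 0 to R^n *)
Definition test_function f : Prop :=
  [/\ smooth f,
      compact (closure [set x | f x != 0]) &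
      closure [set x | f x != 0] `<=` unit_ball].

Lemma measurable_enorm : measurable_fun setT enorm.
Proof.
rewrite /enorm; apply: (measurableT_comp
  (continuous_measurable_fun (@sqrt_continuous R))).
apply: measurable_sum => i; apply: measurable_funX; exact: measurable_coord.
Qed.

Lemma measurable_unit_ball : measurable unit_ball.
Proof.
rewrite (_ : unit_ball = enorm @^-1` `]-oo, 1[).
  by rewrite -[X in measurable X]setTI; exact: measurable_enorm.
by apply/seteqP; split => x; rewrite /= in_itv.
Qed.

End euclidean.
Arguments unit_ball {R n}.

Section hyperbolic.
Context {R : realType} {n : nat}.
Implicit Types (x v w : 'rV[R]_n) (f : 'rV[R]_n -> R).

(* g_x(v, w) for the Poincare metric on the unit ball *)
Definition hmetric x v w : R :=
  4 / (1 - enorm x ^+ 2) ^+ 2 * \sum_i v ord0 i * w ord0 i.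

Definition hlength x v : R := Num.sqrt (hmetric x v v).

Definition hgrad f x : 'rV[R]_n :=
  ((1 - enorm x ^+ 2) ^+ 2 / 4) *: egrad f x.

Lemma hgradP f x v : unit_ball x ->
  hmetric x (hgrad f x) v = \sum_i partial i f x * v ord0 i.
Proof.
move=> x1; rewrite /hmetric /hgrad mulr_sumr; apply: eq_bigr => i _.
have x0 : 1 - enorm x ^+ 2 != 0.
  by rewrite subr_eq0 gt_eqF// exprn_ilt1 ?sqrtr_ge0.
by rewrite !mxE; field.
Qed.

Definition hrho x : R := ln ((1 + enorm x) / (1 - enorm x)).

Definition hdensity x : R := 2 ^+ n / (1 - enorm x ^+ 2) ^+ n.

(* dV_g, as a measure on R^n that does not charge the complement of the ball *)
Definition hvolume (A : set 'rV[R]_n) : \bar R :=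
  (\int[lebesgue_row n]_(x in A `&` unit_ball) (hdensity x)%:E)%E.

Lemma hdensity_ge0 x : unit_ball x -> 0 <= hdensity x.
Proof.
move=> x1; rewrite /hdensity divr_ge0 ?exprn_ge0// subr_ge0.
by rewrite exprn_ile1 ?sqrtr_ge0// ltW.
Qed.

Lemma measurable_hdensity : measurable_fun unit_ball hdensity.
Proof.
apply: (eq_measurable_fun
    (fun x => (2 ^+ n) * ((1 - enorm x ^+ 2) ^+ n) `^ (-1))).
  move=> x; rewrite inE => x1; rewrite powR_inv1// exprn_ge0// subr_ge0.
  by rewrite exprn_ile1 ?sqrtr_ge0// ltW.
apply: measurable_funTS; apply: measurable_funM => //.
apply: (@measurableT_comp _ _ _ _ _ _ (@powR R ^~ (-1))) => //.
apply: measurable_funX; apply: measurable_funB => //.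
by apply: measurable_funX; exact: measurable_enorm.
Qed.

Let hvolume0 : hvolume set0 = 0%E.
Proof. by rewrite /hvolume set0I integral_set0. Qed.

Let hvolume_ge0 A : (0 <= hvolume A)%E.
Proof.
by apply: integral_ge0 => x [_ x1]; rewrite lee_fin hdensity_ge0.
Qed.

Let hvolume_sigma_additive : semi_sigma_additive hvolume.
Proof.
move=> F mF tF mUF; rewrite /hvolume setI_bigcupl ge0_integral_bigcup//=.
- apply: is_cvg_ereal_nneg_natsum_cond => k _ _.
  by apply: integral_ge0 => x [_ x1]; rewrite lee_fin hdensity_ge0.
- by move=> k; apply: measurableI => //; exact: measurable_unit_ball.
- apply/measurable_EFinP; apply: measurable_funS measurable_hdensity.
    exact: measurable_unit_ball.
  by move=> x [k _ []].
- by move=> x [k _ [_ x1]]; rewrite lee_fin hdensity_ge0.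
- exact: trivIset_setIr.
Qed.

HB.instance Definition _ := isMeasure.Build _ _ _ hvolume
  hvolume0 hvolume_ge0 hvolume_sigma_additive.

(* the W^{1,n} norm of f, F playing the role of the Riemannian gradient of f *)
Definition sobolev_norm f (F : 'rV[R]_n -> 'rV[R]_n) : \bar R :=
  ((\int[hvolume]_x (hlength x (F x) ^+ n + `|f x| ^+ n)%:E)
     `^ (n%:R^-1))%E.

(* The completion of C_0^oo in this norm: phi |-> (phi, hgrad phi) embeds
   C_0^oo isometrically in the complete space of pairs (function, vector
   field) with components in L^n, so the completion is the closure of the
   image.  `sobolev0 f F` says that f is (a Borel representative of) an
   element of W^{1,n}_0, with gradient F. *)
Definition sobolev0 f (F : 'rV[R]_n -> 'rV[R]_n) : Prop :=
  [/\ measurable_fun setT f, measurable_fun setT F &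
      exists phi : nat -> 'rV[R]_n -> R,
        (forall k, test_function (phi k)) /\
        (sobolev_norm (fun x => phi k x - f x)
                      (fun x => hgrad (phi k) x - F x) @[k --> \oo]
           --> 0%E)].

End hyperbolic.
Arguments hvolume : clear implicits.

Definition weighted_sobolev {R : realType} (n : nat) (beta q C : R) : Prop :=
  forall (f : 'rV[R]_n -> R) (F : 'rV[R]_n -> 'rV[R]_n), sobolev0 f F ->
  ('N[hvolume R n]_(q%:E)[(fun x => (f x / hrho x `^ (beta / q))%:E)] <=
   (C * q `^ (1 - n%:R^-1))%:E *
   'N[hvolume R n]_((n%:R)%:E)[(fun x => (hlength x (F x))%:E)])%E.

(* Main.v *)
(**
Since |∇_g f|_g^n dV_g = |∇f|^n dx, both sides can be computed on the Euclidean
unit ball.  Write w = 1 - |x|^2 and A_s = ∫ |f|^s w^{-n} dx for a C^1 function f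
with compact support in the ball.

- Hardy: integrating div (|f|^n x w^{1-n}) = 0, whose positive part dominates
  |f|^n w^{-n}, and absorbing with Young's inequality, A_n <= c ∫ |∇f|^n.
- Sobolev: for u = |f|^s w^{1-n}, the Gagliardo-Nirenberg inequality
  ∫ u^κ <= (∫ |∇u|)^κ, κ = n/(n-1), has left-hand side A_{κs}, and when
  ∫ |∇f|^n <= 1 its right-hand side is controlled by A_{κ(s-1)} and A_s, hence
  by A_n and A_{κ(s-1)}.  Starting from κ(s-1) = n, that is from Hardy's
  inequality, this bounds A_t for every t >= n.
- Weight: ρ >= |x|, so that ρ^{-β} matters only near 0, where
  |f|^q |x|^{-β} <= |f|^t + |x|^{-γ} with β < γ < n, and |x|^{-γ} is locally
  integrable because |x|^{-γ} <= Π |x_i|^{-γ/n}.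

Scaling f removes the normalisation of the gradient, and Fatou's lemma along an
almost everywhere convergent subsequence passes to the completion.  The second
inequality is Hölder's inequality for the factorisation
ρ^{(q-β)/q} |f|^2 = (|f| ρ^{-β/q}) (ρ |f|).
*)
Require Import Defs.
From mathcomp Require Import ring lra zify.
Local Open Scope classical_set_scope.
Local Open Scope ring_scope.

Set Implicit Arguments.
Unset Strict Implicit.
Unset Printing Implicit Defensive.

(** * Coordinates, Tonelli on lines and measurability on row vectors *)

(** The constant [C2] may depend on q, so the factor q^(1-1/n) costs nothing: it is divided out at
    the end, and constants may be crude throughout. Both the divergence identity and the hypothesis
    of the Gagliardo-Nirenberg inequality come from the fundamental theorem of calculus on lines
    parallel to an axis; Tonelli does the rest. The obstacle is the weight, which blows up on the
    sphere. It only occurs in products with a function vanishing on |x| >= r for some r < 1. This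
    makes the products C^1 on whole lines, and it makes the left side of Hardy's inequality finite,
    without which half of it could not be absorbed. The radius r enters no final constant, as the
    passage to the completion requires. In that passage only the bound 2^n (J + E_j) on the energy
    of the j-th approximant is used, where J is the energy of the limit gradient and E_j the n-th
    power of the Sobolev distance. *)

Section coordinates.
Context {R : realType}.

Definition upd n (x : 'rV[R]_n) (i : 'I_n) (t : R) : 'rV[R]_n :=
  \row_j if j == i then t else x ord0 j.

Lemma upd_self n (x : 'rV[R]_n) i : upd x i (x ord0 i) = x.
Proof. by apply/rowP => j; rewrite mxE; case: eqP => // ->. Qed.

Lemma row_cons0 n (p : R * 'rV[R]_n) : row_cons p ord0 ord0 = p.1.
Proof. exact: (congr1 fst (row_consK p)). Qed.

Lemma row_cons_lift n (p : R * 'rV[R]_n) j :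
  row_cons p ord0 (lift ord0 j) = p.2 ord0 j.
Proof.
by have /(congr1 snd) /= /rowP/(_ j) := row_consK p; rewrite mxE.
Qed.

Lemma upd_row_cons0 n t (y : 'rV[R]_n) s :
  upd (row_cons (t, y)) ord0 s = row_cons (s, y).
Proof.
apply/rowP => j; rewrite mxE.
by case: (unliftP ord0 j) => [k ->|->]; rewrite ?row_cons0 ?eqxx// !row_cons_lift.
Qed.

Lemma upd_row_cons_lift n t (y : 'rV[R]_n) j s :
  upd (row_cons (t, y)) (lift ord0 j) s = row_cons (t, upd y j s).
Proof.
apply/rowP => k; rewrite mxE.
case: (unliftP ord0 k) => [l ->|->]; rewrite ?row_cons0//.
by rewrite !row_cons_lift/= mxE (inj_eq lift_inj).
Qed.

Lemma measurable_upd n (x : 'rV[R]_n) i :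
  measurable_fun [set: measurableTypeR R] (upd x i).
Proof.
apply/measurable_fun_rowP => j.
have [->|ji] := eqVneq j i.
  by rewrite (_ : (fun _ => _) = id)//; apply/funext => t; rewrite mxE eqxx.
rewrite (_ : (fun _ => _) = cst (x ord0 j)); first exact: measurable_cst.
by apply/funext => t; rewrite mxE (negbTE ji).
Qed.

Section slices.
Variables (n : nat) (d : measure_display) (T : measurableType d).

Lemma measurable_slice (f : 'rV[R]_n.+1 -> T) t :
  measurable_fun setT f -> measurable_fun setT (fun y => f (row_cons (t, y))).
Proof.
move=> mf.
have := measurableT_comp mf (measurable_row_cons (n := n)).
exact: (measurable_fun_pair2 (f := f \o @row_cons R n)).
Qed.

End slices.

Section tonelli.
Local Open Scope ereal_scope.
Variables (n : nat) (f : 'rV[R]_n.+1 -> \bar R).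
Hypotheses (mf : measurable_fun setT f) (f0 : forall x, 0 <= f x).

Let mfc : measurable_fun setT (f \o @row_cons R n).
Proof. exact: (measurableT_comp mf (measurable_row_cons (n:=n))). Qed.

Let prodE : \int[lebesgue_row n.+1]_x f x =
  \int[lebesgue_measure \x lebesgue_row n]_p f (row_cons p).
Proof.
have := @ge0_integral_pushforward _ _ _ _ _ _ (@measurable_row_cons R n)
  (lebesgue_measure \x lebesgue_row n) setT f measurableT mf (fun x _ => f0 x).
rewrite preimage_setT => <-. by apply: eq_measure_integral; first exact: measurable_row_cons.
Qed.

Lemma lebesgue_row_tonelli1 : \int[lebesgue_row n.+1]_x f x =
  \int[lebesgue_measure]_t \int[lebesgue_row n]_y f (row_cons (t, y)).
Proof. by rewrite prodE; exact: (fubini_tonelli1 (f \o @row_cons R n) mfc (fun=> f0 _)). Qed.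

Lemma lebesgue_row_tonelli2 : \int[lebesgue_row n.+1]_x f x =
  \int[lebesgue_row n]_y \int[lebesgue_measure]_t f (row_cons (t, y)).
Proof. by rewrite prodE; exact: (fubini_tonelli2 (f \o @row_cons R n) mfc (fun=> f0 _)). Qed.

Lemma measurable_integral_slice : measurable_fun [set: measurableTypeR R]
  (fun t => \int[lebesgue_row n]_y f (row_cons (t, y))).
Proof.
exact: (measurable_fun_fubini_tonelli_F (f \o @row_cons R n) mfc (fun=> f0 _)).
Qed.

Lemma measurable_integral_slice0 : measurable_fun setT
  (fun y => \int[lebesgue_measure]_t f (row_cons (t, y))).
Proof.
exact: (measurable_fun_fubini_tonelli_G (f \o @row_cons R n) mfc (fun=> f0 _)).
Qed.

End tonelli.

(** Lifts an inequality between integrals on all lines of direction i to the whole space. Induction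
    on the dimension: if i is the first coordinate, Tonelli puts the line integral inside; otherwise
    the first coordinate is frozen and the induction hypothesis applies to the slices. *)
Lemma le_integral_lines n (f g : 'rV[R]_n -> \bar R) (i : 'I_n) :
  measurable_fun setT f -> (forall x, 0 <= f x)%E ->
  measurable_fun setT g -> (forall x, 0 <= g x)%E ->
  (forall x, \int[lebesgue_measure]_t f (upd x i t) <=
             \int[lebesgue_measure]_t g (upd x i t))%E ->
  (\int[lebesgue_row n]_x f x <= \int[lebesgue_row n]_x g x)%E.
Proof.
elim: n => [|n IH] in f g i *; first by case: i.
move=> mf f0 mg g0 fg.
case: (unliftP ord0 i) => [j ij|i0].
- rewrite !lebesgue_row_tonelli1//; apply: ge0_le_integral => //.
  + by move=> t _; exact: integral_ge0.
  + exact: measurable_integral_slice.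
  + exact: measurable_integral_slice.
  + move=> t _; apply: (IH _ _ j) => //; [exact: measurable_slice..|] => y.
    have := fg (row_cons (t, y)); rewrite ij.
    by under eq_integral do rewrite upd_row_cons_lift;
       under [X in (_ <= X)%E -> _]eq_integral do rewrite upd_row_cons_lift.
- rewrite !lebesgue_row_tonelli2//; apply: ge0_le_integral => //.
  + by move=> t _; exact: integral_ge0.
  + exact: measurable_integral_slice0.
  + exact: measurable_integral_slice0.
  (* The value 0 is arbitrary: [upd] overwrites the first coordinate. *)
  + move=> y _; have := fg (row_cons (0, y)); rewrite i0.
    by under eq_integral do rewrite upd_row_cons0;
       under [X in (_ <= X)%E -> _]eq_integral do rewrite upd_row_cons0.
Qed.

End coordinates.

(* A continuous function is the pointwise limit of the functions obtained by
   rounding the coordinates to multiples of 1/(k+1), which have countably many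
   values. *)
Lemma continuous_measurable_row {R : realType} n (f : 'rV[R]_n -> R) :
  continuous f -> measurable_fun setT f.
Proof.
move=> cf.
pose rnd (k : nat) (x : 'rV[R]_n) : 'rV[R]_n :=
  \row_i ((Num.floor (x ord0 i * k.+1%:R))%:~R / k.+1%:R).
have rndE k (x : 'rV[R]_n) i : `|x ord0 i - rnd k x ord0 i| <= k.+1%:R^-1.
  rewrite mxE -[X in `|X - _|](@mulfK _ k.+1%:R)// -mulrBl normrM normfV.
  rewrite (ger0_norm (ler0n _ _)) ler_piMl ?invr_ge0//.
  have /andP[h1 h2] := floor_itv (x ord0 i * k.+1%:R).
  by rewrite ger0_norm ?subr_ge0// lerBlDl ltW// -[1]/(1%:~R) -intrD.
apply: (@measurable_fun_cvg _ _ _ setT (fun k => f \o rnd k)) => //; last first.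
  move=> x _; apply: (cvg_comp (rnd^~ x) f); last exact: cf.
  apply/cvg_mx_entourageP => A entA.
  rewrite -entourage_ballE in entA; case: entA => e /= e0 eA.
  change (\forall k \near \oo, forall i j, (x i j, rnd k x i j) \in A).
  near=> k => i j; rewrite (ord1 i) inE; apply: eA; rewrite /= /ball /=.
  apply: le_lt_trans (rndE k x j) _.
  by near: k; exact: near_infty_natSinv_lt (PosNum e0).
move=> k.
pose fl (x : 'rV[R]_n) : 'rV[int]_n := \row_i Num.floor (x ord0 i * k.+1%:R).
pose g (v : 'rV[int]_n) : R := f (\row_i ((v ord0 i)%:~R / k.+1%:R)).
have -> : f \o rnd k = g \o fl.
  by apply/funext => x /=; congr f; apply/rowP => i; rewrite !mxE.
move=> _ B mB; rewrite setTI.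
have -> : (g \o fl) @^-1` B = \bigcup_v (fl @^-1` [set v] `&` [set _ | B (g v)]).
  apply/seteqP; split=> [x /= Bx|x [v _ [/= -> //]]].
  by exists (fl x).
apply: countable_bigcupT_measurable => [|v]; first exact: countableP.
apply: measurableI; last first.
  have [Bg|Bg] := pselect (B (g v)).
    by rewrite (_ : [set _ | _] = setT)//; apply/seteqP; split.
  by rewrite (_ : [set _ | _] = set0)//; apply/seteqP; split.
have -> : fl @^-1` [set v] = \bigcap_(i in [set: 'I_n])
    [set x : 'rV[R]_n | Num.floor (x ord0 i * k.+1%:R) = v ord0 i].
  apply/seteqP; split=> [x /= <- i _|x /= xv]; first by rewrite /= mxE.
  by apply/rowP => i; rewrite mxE; exact: xv.
apply: fin_bigcap_measurable => [|i _]; first exact: finite_finset.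
have -> : [set x : 'rV[R]_n | Num.floor (x ord0 i * k.+1%:R) = v ord0 i] =
  (fun x : 'rV[R]_n => x ord0 i * k.+1%:R) @^-1`
    [set` `[(v ord0 i)%:~R, (v ord0 i + 1)%:~R[].
  apply/seteqP; split => x /=; rewrite in_itv/=.
    by move=> <-; exact: floor_itv.
  by move=> ?; exact: floor_def.
rewrite -[X in measurable X]setTI.
by apply: measurable_funM => //; exact: measurable_coord.
Unshelve. all: by end_near. Qed.

(** * One-dimensional integration by parts *)

Section line_integrals.
Context {R : realType}.
Notation mu := (@lebesgue_measure R).
Implicit Types (g dg a b : R -> R).

Section ftc.
Variables g dg : R -> R.
Hypothesis g_dg : forall t : R, is_derive t 1 g (dg t).
Hypothesis cdg : continuous dg.
Hypothesis g1 : forall t, 1 <= `|t| -> g t = 0 /\ dg t = 0.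

Let cg : continuous g.
Proof.
move=> t; apply: differentiable_continuous.
by apply/derivable1_diffP; have [] := g_dg t.
Qed.

Let ftc u v : u < v ->
  (\int[mu]_(t in `[u, v]) (dg t)%:E = (g v)%:E - (g u)%:E)%E.
Proof.
move=> uv; apply: continuous_FTC2 => //.
- exact: continuous_subspaceT.
- split=> [t _||]; first by have [] := g_dg t.
  + by apply: cvg_at_right_filter; exact: cg.
  + by apply: cvg_at_left_filter; exact: cg.
- by move=> t _; rewrite derive1E; have [_ ->] := g_dg t.
Qed.

Let mdg : measurable_fun setT dg.
Proof. exact: continuous_measurable_fun. Qed.

(** [g] vanishes at -1, so [g t] is the integral of [dg] from -1 to t. This is the source of the
    line domination in the Sobolev step. *)
Lemma le_integral_derive t :
  ((`|g t|)%:E <= \int[mu]_s (`|dg s|)%:E)%E.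
Proof.
have [t1|t1] := leP 1 `|t|.
  by have [-> _] := g1 t1; rewrite normr0 integral_ge0// => s _; rewrite lee_fin.
have t1' : -1 < t by move: t1; rewrite ltr_norml => /andP[].
have [gN1 _] : g (-1) = 0 /\ dg (-1) = 0 by apply: g1; rewrite normrN1.
have -> : (`|g t|%:E = `| \int[mu]_(s in `[(-1)%R, t]) (dg s)%:E |)%E.
  by rewrite ftc// gN1 sube0.
have m1t : measurable_fun `[(-1)%R, t] (EFin \o dg).
  by apply/measurable_EFinP; exact: measurable_funTS.
apply: le_trans; first exact: (le_abse_integral mu _ m1t).
apply: ge0_subset_integral => //.
apply/measurable_EFinP; exact: measurableT_comp.
Qed.

Let dg_restrict : (EFin \o dg) \_ `[(-1)%R, 1%R] = EFin \o dg.
Proof.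
apply/funext => t; rewrite patchE; case: ifPn => // tI.
have [|_ /= ->//] := @g1 t; rewrite leNgt; apply: contra tI.
by rewrite ltr_norml => /andP[h1 h2]; rewrite inE/= in_itv/= !ltW.
Qed.

Let integrable_dg : mu.-integrable setT (EFin \o dg).
Proof.
rewrite -dg_restrict -integrable_mkcond//.
apply: continuous_compact_integrable; first exact: segment_compact.
exact: continuous_subspaceT.
Qed.

Let integral_dg : (\int[mu]_t (dg t)%:E = 0)%E.
Proof.
have -> : (fun t => (dg t)%:E) = (EFin \o dg) \_ `[(-1)%R, 1%R].
  by rewrite dg_restrict.
rewrite -integral_mkcond ftc; last by lra.
have [-> _] : g 1 = 0 /\ dg 1 = 0 by apply: g1; rewrite normr1.
have [-> _] : g (-1) = 0 /\ dg (-1) = 0 by apply: g1; rewrite normrN1.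
by rewrite subee.
Qed.

(** [dg] has integral 0: one coordinate of the identity that a compactly supported field has a
    divergence of integral zero. If [b] has infinite integral there is nothing to prove; otherwise
    [dg + b] is integrable and integrals may be added. *)
Lemma le_integral_add_derive a b :
  measurable_fun setT a -> (forall t, 0 <= a t) ->
  measurable_fun setT b -> (forall t, 0 <= b t) ->
  (forall t, a t <= dg t + b t) ->
  (\int[mu]_t (a t)%:E <= \int[mu]_t (b t)%:E)%E.
Proof.
move=> ma a0 mb b0 ab.
have [bfin|] := ltP (\int[mu]_t (b t)%:E)%E +oo%E; last first.
  by rewrite leye_eq => /eqP ->; rewrite leey.
have ib : mu.-integrable setT (EFin \o b).
  apply/integrableP; split; first exact/measurable_EFinP.
  by under eq_integral do rewrite /= ger0_norm//.
have <- : (\int[mu]_t ((dg t)%:E + (b t)%:E) = \int[mu]_t (b t)%:E)%E.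
  transitivity (\int[mu]_t ((EFin \o dg) t + (EFin \o b) t))%E => //.
  by rewrite integralD//= integral_dg add0e.
apply: ge0_le_integral => //.
- by move=> t _; rewrite lee_fin.
- exact/measurable_EFinP.
- by apply/measurable_EFinP; exact: measurable_funD.
- by move=> t _; rewrite -EFinD lee_fin.
Qed.

End ftc.

Lemma cvg_pow (T : Type) (F : set_system T) (FF : Filter F) (f : T -> R) (l : R) k :
  f @ F --> l -> (fun x => f x ^+ k) @ F --> l ^+ k.
Proof. by move=> fl; exact: (cvg_comp f (fun x => x ^+ k) fl (@exprn_continuous R k l)). Qed.

Lemma is_derive_pow g (t dgt : R) k : is_derive t 1 g dgt ->
  is_derive t 1 (fun s => g s ^+ k) (k%:R * g t ^+ k.-1 * dgt).
Proof.
move=> gt; have := @is_deriveX R R g k t 1 dgt gt.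
rewrite (_ : g ^+ k = fun s => g s ^+ k)//.
by apply/funext => s; elim: k => [|k IH]; rewrite ?expr0// !exprS -IH.
Qed.

(** An exponent of at least 2 makes the power of the absolute value differentiable at 0, where the
    difference quotient is |h|^k h. *)
Lemma is_derive_norm_pow k (y : R) :
  is_derive y 1 (fun x : R => `|x| ^+ k.+2) (k.+2%:R * `|y| ^+ k * y).
Proof.
have idd (x : R) : is_derive x 1 (id : R -> R) 1 by exact: is_derive_id.
have [y0|y0|->] := ltgtP y 0.
- apply: (near_eq_is_derive (f := fun x : R => (- x) ^+ k.+2)).
    near=> x; rewrite ltr0_norm//; near: x; exact: lt_nbhsl.
  apply: is_derive_eq; first by apply: is_derive_pow; exact: is_deriveNid.
  by rewrite /= ltr0_norm// exprSr; ring.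
- apply: (near_eq_is_derive (f := fun x : R => x ^+ k.+2)).
    near=> x; rewrite gtr0_norm//; near: x; exact: lt_nbhsr.
  apply: is_derive_eq; first by apply: is_derive_pow; exact: is_derive_id.
  by rewrite /= gtr0_norm// exprSr; ring.
- rewrite mulr0.
  have c0 : (`|h| ^+ k * h) @[h --> (0 : R)^'] --> (0 : R).
    suff: (`|h| ^+ k * h) @[h --> (0 : R)^'] --> `|0 : R| ^+ k * 0.
      by rewrite mulr0.
    apply: cvg_within_filter; apply: cvgM; last exact: cvg_id.
    by apply: cvg_pow; exact: (@norm_continuous _ R (0 : R)).
  have H : h^-1 *: (`|h *: 1 + (0 : R)| ^+ k.+2 - `|0 : R| ^+ k.+2)
      @[h --> (0 : R)^'] --> (0 : R).
    apply: cvg_trans c0; apply: near_eq_cvg; near=> h.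
    have h0 : h != 0 by near: h; exact: nbhs_dnbhs_neq.
    rewrite addr0 [h *: 1]mulr1 normr0 expr0n subr0 2!exprS.
    by rewrite mulrA [X in X * `|h| ^+ k]mulrC -expr2 real_normK ?num_real//
      [_ *: _]mulrC -mulrA; field.
  by apply: DeriveDef; [apply/cvg_ex; exists 0|apply/cvg_lim].
Unshelve. all: by end_near. Qed.
End line_integrals.

(** * Euclidean norm, and C^1 functions of the ball along coordinate lines *)

Section euclidean_norm.
Context {R : realType} {n : nat}.
Implicit Types (x : 'rV[R]_n).

Lemma enorm_ge0 x : 0 <= enorm x. Proof. exact: sqrtr_ge0. Qed.

Lemma enorm_sqr x : enorm x ^+ 2 = \sum_i x ord0 i ^+ 2.
Proof. by rewrite sqr_sqrtr// sumr_ge0// => i _; exact: sqr_ge0. Qed.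

Lemma le_coord_enorm x i : `|x ord0 i| <= enorm x.
Proof.
rewrite -(@ler_pXn2r _ 2)// ?nnegrE ?enorm_ge0// enorm_sqr real_normK ?num_real//.
by rewrite (bigD1 i)//= lerDl sumr_ge0// => j _; exact: sqr_ge0.
Qed.

Lemma enorm_upd x i t :
  enorm (upd x i t) ^+ 2 = \sum_(j | j != i) x ord0 j ^+ 2 + t ^+ 2.
Proof.
rewrite enorm_sqr (bigD1 i)//= mxE eqxx addrC; congr (_ + _).
by apply: eq_bigr => j /negbTE ji; rewrite mxE ji.
Qed.

Lemma upd_shift x i h t : upd x i (h + t) = h *: delta_mx ord0 i + upd x i t.
Proof.
apply/rowP => j; rewrite !mxE eqxx/=.
by case: eqP => _; rewrite ?mulr1// mulr0 add0r.
Qed.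

Lemma continuous_upd x i : continuous (upd x i).
Proof.
move=> t; have -> : upd x i = fun s => s *: delta_mx ord0 i + upd x i 0.
  by apply/funext => s; rewrite -[in LHS](addr0 s) upd_shift.
apply: cvgD; last exact: cvg_cst.
by apply: cvgZr_tmp; exact: cvg_id.
Qed.

Lemma is_derive_upd (f : 'rV[R]_n -> R) x i (t : R) :
  derivable f (upd x i t) (delta_mx ord0 i) ->
  is_derive t 1 (fun s => f (upd x i s)) (partial i f (upd x i t)).
Proof.
move=> df.
have E : (fun h => h^-1 *: ((fun s => f (upd x i s)) (h *: 1 + t) - f (upd x i t)))
   = (fun h => h^-1 *: (f (h *: delta_mx ord0 i + upd x i t) - f (upd x i t))).
  by apply/funext => h /=; rewrite -upd_shift [h *: 1]mulr1.
apply: DeriveDef; first by rewrite /derivable /= E.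
by rewrite /derive /= E.
Qed.

End euclidean_norm.

(** All that is kept of a test function: one continuous derivative, and a support at positive
    distance from the sphere. Unlike smoothness, this needs no argument on iterated derivatives when
    the function is rescaled. *)
Record c1_ball {R : realType} n (f : 'rV[R]_n -> R) (r : R) : Prop := C1Ball {
  c1_ge0 : 0 <= r;
  c1_lt1 : r < 1;
  c1_continuous : continuous f;
  c1_derivable : forall i x, derivable f x (delta_mx ord0 i);
  c1_partial : forall i, continuous (partial i f);
  c1_support : forall x, r <= enorm x -> f x = 0 /\ forall i, partial i f x = 0 }.

Section lines.
Context {R : realType} {n : nat}.
Notation mu := (@lebesgue_measure R).
Variables (f : 'rV[R]_n -> R) (r : R) (fr : c1_ball f r).
Variables (x : 'rV[R]_n) (i : 'I_n).

Let ph t := f (upd x i t).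
Let dph t := partial i f (upd x i t).
Let W t := 1 - enorm (upd x i t) ^+ 2.

Let ph_dph (t : R) : is_derive t 1 ph (dph t).
Proof. by apply: is_derive_upd; exact: (c1_derivable fr). Qed.

Let cph : continuous ph.
Proof.
by move=> t; apply: continuous_comp; [exact: continuous_upd|exact: (c1_continuous fr)].
Qed.

Let cdph : continuous dph.
Proof.
move=> t; apply: continuous_comp; first exact: continuous_upd.
exact: (c1_partial fr).
Qed.

Let c := 1 - \sum_(j | j != i) x ord0 j ^+ 2.

Let WE : W = fun t => c - t ^+ 2.
Proof. by apply/funext => t; rewrite /W enorm_upd /c; ring. Qed.

Let cW : continuous W.
Proof.
rewrite WE => t; apply: cvgB; first exact: cvg_cst.
exact: exprn_continuous.
Qed.

Let ph0 t : W t <= 1 - r ^+ 2 -> ph t = 0 /\ dph t = 0.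
Proof.
have [r0 _ _ _ _ f0] := fr; rewrite /W lerD2l lerN2 => rt.
have : r <= enorm (upd x i t) by move: rt; rewrite ler_pXn2r// nnegrE enorm_ge0.
by move=> /f0[h1 h2]; split => //; exact: h2.
Qed.

Let r2 : 0 < 1 - r ^+ 2.
Proof. by have [r0 r1 _ _ _ _] := fr; rewrite subr_gt0 expr_lt1. Qed.

(** [f] vanishes as soon as [W] is at most 1 - r^2, a positive number, so by continuity it vanishes
    in a neighbourhood of every point where the weight is singular or has the wrong sign. Hence a
    weight need only be regular inside the ball. *)
Let near0 (t : R) : W t <= 0 -> \forall s \near t, ph s = 0 /\ dph s = 0.
Proof.
move=> Wt; have : \forall s \near t, W s < 1 - r ^+ 2.
  have := cW (x := t); move/cvgr_lt; apply.
  exact: le_lt_trans Wt r2.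
by apply: filterS => s /ltW; exact: ph0.
Qed.

Let out t : 1 <= `|t| -> W t <= 0.
Proof.
move=> t1; rewrite /W subr_le0 enorm_upd.
rewrite (le_trans (_ : 1 <= t ^+ 2))//.
  by rewrite -(real_normK (num_real t)) exprn_ege1.
by rewrite lerDr sumr_ge0// => j _; exact: sqr_ge0.
Qed.

Section weight.
Variables (ps dps : R -> R) (k : nat).
Hypothesis ps_dps : forall t, 0 < 1 - enorm (upd x i t) ^+ 2 ->
  is_derive t 1 ps (dps t) /\ {for t, continuous dps}.

(** [ps] is a power of 1/w in the Sobolev step, and t times such a power in Hardy's inequality. *)
Definition line_fun t := `|f (upd x i t)| ^+ k.+2 * ps t.
Definition line_derive t :=
  k.+2%:R * `|f (upd x i t)| ^+ k * f (upd x i t) * partial i f (upd x i t) * ps t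
  + `|f (upd x i t)| ^+ k.+2 * dps t.

Let line_is_derive (t : R) : is_derive t 1 line_fun (line_derive t).
Proof.
have [W0|W0] := leP (W t) 0.
  have nz := near0 W0.
  apply: (near_eq_is_derive (f := cst 0)).
    by apply: filterS nz => s [h _]; rewrite /line_fun -/(ph s) h normr0 !expr0n/= mul0r.
  apply: (is_derive_eq (is_derive_cst (0 : R^o) (t : R^o) 1)).
  have [h1 h2] := nbhs_singleton nz.
  by rewrite /line_derive -/(ph t) h1 normr0 !expr0n/= !(mulr0, mul0r) addr0.
have [dp _] := ps_dps W0.
have dq := is_derive1_comp (is_derive_norm_pow k (ph t)) (ph_dph t).
have := is_deriveM dq dp.
move=> /is_derive_eq; apply; rewrite /line_derive /GRing.scale /= -/(ph t) -/(dph t).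
by ring.
Qed.

Let line_continuous : continuous line_derive.
Proof.
move=> t; have [W0|W0] := leP (W t) 0.
  have nz := near0 W0.
  have E : \forall s \near t, 0 = line_derive s.
    apply: filterS nz => s [h1 h2].
    by rewrite /line_derive -/(ph s) h1 normr0 !expr0n/= !(mulr0, mul0r) addr0.
  rewrite /continuous_at -(nbhs_singleton E).
  by apply: (cvg_trans (near_eq_cvg E)); exact: cvg_cst.
have [dp cdps] := ps_dps W0.
have cps : {for t, continuous ps}.
  by apply: differentiable_continuous; apply/derivable1_diffP; have [] := dp.
have cnph : `|ph s| @[s --> t] --> `|ph t| by apply: cvg_norm; exact: cph.
apply: cvgD; apply: cvgM => //; last by apply: cvg_pow.
by do 2 (apply: cvgM; last by [exact: cdph|exact: cph]);
  apply: cvgM; [exact: cvg_cst|exact: cvg_pow].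
Qed.

Let line_out t : 1 <= `|t| -> line_fun t = 0 /\ line_derive t = 0.
Proof.
move=> /out Wt; have [h1 _] := nbhs_singleton (near0 Wt).
by rewrite /line_fun /line_derive -/(ph t) h1 normr0 expr0n/=
  !(mulr0, mul0r) addr0.
Qed.

Lemma line_sobolev t :
  ((`|line_fun t|)%:E <= \int[mu]_s (`|line_derive s|)%:E)%E.
Proof. exact: (le_integral_derive line_is_derive line_continuous line_out). Qed.

Lemma measurable_line_derive : measurable_fun setT line_derive.
Proof. exact: continuous_measurable_fun. Qed.

Lemma line_hardy (a b : R -> R) :
  measurable_fun setT a -> (forall t, 0 <= a t) ->
  measurable_fun setT b -> (forall t, 0 <= b t) ->
  (forall t, a t <= line_derive t + b t) ->
  (\int[mu]_t (a t)%:E <= \int[mu]_t (b t)%:E)%E.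
Proof.
exact: (le_integral_add_derive line_is_derive line_continuous line_out).
Qed.

End weight.

Lemma is_derive_weight m (t : R) : 0 < 1 - enorm (upd x i t) ^+ 2 ->
  let V s := (1 - enorm (upd x i s) ^+ 2)^-1 in
  is_derive t 1 (fun s => V s ^+ m) (m%:R * V t ^+ m.+1 * (2 * t)) /\
  {for t, continuous (fun s => m%:R * V s ^+ m.+1 * (2 * s))}.
Proof.
move=> W0 V; have Wn0 : W t != 0 by rewrite gt_eqF.
have cV : V s @[s --> t] --> V t by apply: cvgV => //; exact: cW.
split.
  have dW : is_derive t 1 W (- (2 * t)).
    rewrite WE; have -> : - (2 * t) = 0 - 2%:R * t ^+ 1 * 1 by rewrite expr1; ring.
    apply: is_deriveB; apply: is_derive_pow; exact: is_derive_id.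
  apply: is_derive_eq; first exact: (is_derive_pow m (is_deriveV Wn0 dW)).
  rewrite /V -/(W t); case: m => [|m]; first by rewrite !mul0r.
  by rewrite /= !exprS /GRing.scale/=; field.
apply: cvgM; first by apply: cvgM; [exact: cvg_cst|exact: cvg_pow].
by apply: cvgM; [exact: cvg_cst|exact: cvg_id].
Qed.

Lemma is_derive_id_weight m (t : R) : 0 < 1 - enorm (upd x i t) ^+ 2 ->
  let V s := (1 - enorm (upd x i s) ^+ 2)^-1 in
  is_derive t 1 (fun s => s * V s ^+ m)
    (V t ^+ m + 2 * m%:R * t ^+ 2 * V t ^+ m.+1) /\
  {for t, continuous (fun s => V s ^+ m + 2 * m%:R * s ^+ 2 * V s ^+ m.+1)}.
Proof.
move=> W0 V; have [dV _] := is_derive_weight m W0.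
have Wn0 : W t != 0 by rewrite gt_eqF.
have cV : V s @[s --> t] --> V t by apply: cvgV => //; exact: cW.
split.
  have := is_deriveM (is_derive_id t (1 : R)) dV.
  by move=> /is_derive_eq; apply; rewrite /GRing.scale/= -/V; ring.
apply: cvgD; first exact: cvg_pow.
apply: cvgM; last exact: cvg_pow.
by apply: cvgM; [exact: cvg_cst|exact: exprn_continuous].
Qed.

End lines.

(** * The Gagliardo-Nirenberg inequality *)

Section hoelder_nonneg.
Context d (T : measurableType d) (R : realType).
Variable mu : {measure set T -> \bar R}.
Local Open Scope ereal_scope.

Lemma Lnorm_EFinE (r : R) (u : T -> R) :
  'N[mu]_(r%:E)[(fun x => (u x)%:E)] = (\int[mu]_x (`|u x| `^ r)%:E) `^ r^-1.
Proof. by rewrite Lnorm.unlock. Qed.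

Lemma hoelder_ge0 (f g : T -> R) (p q : R) :
  measurable_fun setT f -> measurable_fun setT g ->
  (forall x, 0 <= f x)%R -> (forall x, 0 <= g x)%R ->
  (0 < p)%R -> (0 < q)%R -> (p^-1 + q^-1 = 1)%R ->
  \int[mu]_x (f x * g x)%:E <=
  (\int[mu]_x (f x `^ p)%:E) `^ p^-1 * (\int[mu]_x (g x `^ q)%:E) `^ q^-1.
Proof.
move=> mf mg f0 g0 p0 q0 pq.
have NE (u : T -> R) (r : R) : (forall x, 0 <= u x)%R ->
    'N[mu]_(r%:E)[EFin \o u] = (\int[mu]_x (u x `^ r)%:E) `^ r^-1.
  move=> u0; rewrite Lnorm_EFinE; apply: (congr1 (fun z => poweR z r^-1)).
  by apply: eq_integral => x _; rewrite ger0_norm.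
rewrite -!NE//; apply: le_trans (hoelder mu mf mg p0 q0 pq); rewrite Lnorm1.
by rewrite le_eqVlt; apply/orP; left; apply/eqP/eq_integral => x _;
  rewrite /= ger0_norm ?mulr_ge0.
Qed.

End hoelder_nonneg.

Section gagliardo.
Context {R : realType}.
Local Open Scope ereal_scope.
Notation mu := (@lebesgue_measure R).

(** [h] stands for the length of the gradient of a compactly supported [u]. This is all that the
    Gagliardo-Nirenberg argument needs, and it passes to slices, as the induction on the dimension
    requires. *)
Definition dominated_on_lines n (u h : 'rV[R]_n -> R) :=
  [/\ measurable_fun setT u, forall x, (0 <= u x)%R,
      measurable_fun setT h, forall x, (0 <= h x)%R &
      forall i x, (u x)%:E <= \int[mu]_t (h (upd x i t))%:E].

(* Dual form of the inequality: it still makes sense for n = 0, that is on the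
   line, where the exponent of u is infinite. *)
Definition gagliardo_dual n := forall u h g : 'rV[R]_n.+1 -> R,
  dominated_on_lines u h ->
  measurable_fun setT g -> (forall x, (0 <= g x)%R) ->
  \int[lebesgue_row n.+1]_x (u x * g x)%:E <=
  \int[lebesgue_row n.+1]_x (h x)%:E *
  (\int[lebesgue_row n.+1]_x (g x ^+ n.+1)%:E) `^ (n.+1%:R^-1).

(** On the line, [u] is bounded by the integral of [h], which is taken out as a constant. The Dirac
    mass appears because the line is encoded as the product of R with the one-point space R^0. *)
Lemma gagliardo_dual0 : gagliardo_dual 0.
Proof.
move=> u h g [mu_ u0 mh h0 uh] mg g0.
under [X in _ <= _ * X `^ _]eq_integral do rewrite expr1.
rewrite invr1 poweRe1; last by apply: integral_ge0 => x _; rewrite lee_fin.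
rewrite -ge0_integralZl//; first last.
- by apply: integral_ge0 => x _; rewrite lee_fin.
- by move=> x _; rewrite lee_fin.
- exact/measurable_EFinP.
apply: ge0_le_integral => //.
- by move=> x _; rewrite lee_fin mulr_ge0.
- by apply/measurable_EFinP; exact: measurable_funM.
- by apply: measurable_funeM; exact/measurable_EFinP.
move=> x _; rewrite EFinM lee_wpmul2r ?lee_fin//.
apply: le_trans (uh ord0 x) _.
rewrite lebesgue_row_tonelli2//=; last exact/measurable_EFinP.
rewrite integral_dirac//=; last first.
  apply: (measurable_integral_slice0 (f := EFin \o h)); first exact/measurable_EFinP.
  by move=> y; rewrite lee_fin.
rewrite diracT mul1e le_eqVlt; apply/orP; left; apply/eqP.
apply: eq_integral => t _; congr (h _)%:E.
apply/rowP => j; rewrite mxE (ord1 j) eqxx.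
exact: (esym (row_cons0 (t, 0%R))).
Qed.

(* u^(1 + 1/(n+1)) <= u H^(1/(n+1)) where H y = ∫ h (s, y) ds does not depend on
   the first coordinate, so that the dual form applies to each slice. *)
Lemma gagliardo_step n (u h : 'rV[R]_n.+2 -> R) : gagliardo_dual n ->
  dominated_on_lines u h ->
  \int[lebesgue_row n.+2]_x (u x `^ (n.+2%:R / n.+1%:R))%:E <=
  (\int[lebesgue_row n.+2]_x (h x)%:E) `^ (n.+2%:R / n.+1%:R).
Proof.
move=> IH [mu_ u0 mh h0 uh].
set k : R := (n.+2%:R / n.+1%:R)%R.
have k0 : (0 < k)%R by rewrite divr_gt0.
have kE : (k = 1 + n.+1%:R^-1)%R.
  by rewrite /k -natr1 mulrDl divff ?mul1r// addrC addrC.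
have mhE : measurable_fun setT (EFin \o h) by exact/measurable_EFinP.
have hE0 (x : 'rV_n.+2) : 0 <= (h x)%:E by rewrite lee_fin.
have [hoo|] := ltP (\int[lebesgue_row n.+2]_x (h x)%:E) +oo; last first.
  by rewrite leye_eq => /eqP ->; rewrite poweRyr ?leey// gt_eqF.
pose H0 (y : 'rV[R]_n.+1) := \int[mu]_t (h (row_cons (t, y)))%:E.
have H00 y : 0 <= H0 y by apply: integral_ge0 => t _.
have mH0 : measurable_fun setT H0.
  exact: (measurable_integral_slice0 (f := EFin \o h)).
have intH0 : \int[lebesgue_row n.+1]_y H0 y = \int[lebesgue_row n.+2]_x (h x)%:E.
  by rewrite [RHS](lebesgue_row_tonelli2 (f := EFin \o h)).
have iH0 : (lebesgue_row n.+1).-integrable setT H0.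
  apply/integrableP; split=> //.
  by under eq_integral do rewrite gee0_abs//; rewrite intH0.
have aefin := integrable_ae measurableT iH0.
(* The (n+1)-th power of [g] is [H0] almost everywhere, with the same integral as [h]; [fine] is
   harmless because [H0] is finite almost everywhere. *)
pose g y : R := (fine (H0 y) `^ (n.+1%:R^-1))%R.
have mfH0 : measurable_fun setT (fine \o H0) by exact: measurableT_comp.
have mg : measurable_fun setT g.
  exact: (measurableT_comp (measurable_powR _) mfH0).
have g0 y : (0 <= g y)%R by exact: powR_ge0.
have intg : \int[lebesgue_row n.+1]_y (g y ^+ n.+1)%:E =
            \int[lebesgue_row n.+2]_x (h x)%:E.
  rewrite -intH0; apply: ae_eq_integral => //.
    by apply/measurable_EFinP; exact: measurable_funX.
  apply: filterS aefin => y /= + _ => /(_ I) yfin.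
  rewrite -powR_mulrn// -powRrM mulVf// powRr1 ?fineK//.
  exact: fine_ge0.
have mui : measurable_fun setT (fun x => (u x `^ k)%:E).
  by apply/measurable_EFinP; exact: (measurableT_comp (measurable_powR _) mu_).
rewrite lebesgue_row_tonelli1//; last by move=> x; rewrite lee_fin powR_ge0.
apply: (@le_trans _ _ (\int[mu]_t (\int[lebesgue_row n.+1]_y
    (h (row_cons (t, y)))%:E *
    (\int[lebesgue_row n.+2]_x (h x)%:E) `^ (n.+1%:R^-1)))).
  apply: ge0_le_integral => //.
  - move=> t _; apply: integral_ge0 => y _; by rewrite lee_fin powR_ge0.
  - apply: (measurable_integral_slice (f := fun x => (u x `^ k)%:E)) => //.
    by move=> x; rewrite lee_fin powR_ge0.
  - apply: emeasurable_funM => //.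
    exact: (measurable_integral_slice (f := EFin \o h)).
  (* The constant factor is rewritten with [g], so that the right side is that of the dual form on
     the slice at t. *)
  move=> t _; rewrite -intg.
  have mut : measurable_fun setT (fun y => u (row_cons (t, y))).
    exact: measurable_slice.
  apply: (@le_trans _ _ (\int[lebesgue_row n.+1]_y
      (u (row_cons (t, y)) * g y)%:E)).
    apply: ae_ge0_le_integral => //.
    - by move=> y _; rewrite lee_fin powR_ge0.
    - exact: (measurable_slice (f := fun x => (u x `^ k)%:E)).
    - by move=> y _; rewrite lee_fin mulr_ge0.
    - by apply/measurable_EFinP; exact: measurable_funM.
    apply: filterS aefin => y /= + _ => /(_ I) yfin.
    rewrite lee_fin kE; have [->|ut] := eqVneq (u (row_cons (t, y))) 0%R.
      by rewrite powR0 ?mul0r// gt_eqF// addr_gt0// invr_gt0.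
    rewrite powRD ?ut ?implybT// powRr1// ler_wpM2l//.
    apply: ge0_ler_powR; rewrite ?nnegrE ?invr_ge0//; first exact: fine_ge0.
    rewrite -lee_fin fineK//; apply: le_trans (uh ord0 _) _.
    by under eq_integral do rewrite upd_row_cons0.
  apply: IH => //; split => //; first exact: measurable_slice.
  move=> i y; apply: le_trans (uh (lift ord0 i) _) _.
  by under eq_integral do rewrite upd_row_cons_lift.
rewrite ge0_integralZr//; first last.
- exact: poweR_ge0.
- by move=> t _; apply: integral_ge0.
- exact: (measurable_integral_slice (f := EFin \o h)).
rewrite -(lebesgue_row_tonelli1 (f := EFin \o h))//=.
rewrite kE.
set I := \int[_]_x (h x)%:E.
have I0 : 0 <= I by apply: integral_ge0.
have [->|In0] := eqVneq I 0.
  by rewrite mul0e poweR_ge0.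
by rewrite poweRD ?poweRe1//; apply: add_neq0_poweRD_def; rewrite -kE gt_eqF.
Qed.

(** The induction alternates two forms: [gagliardo_step] turns the dual form in one dimension into
    the power form in the next, and Hölder's inequality with the conjugate exponents (n+2)/(n+1) and
    n+2 turns this back into a dual form. *)
Lemma gagliardo_dualP n : gagliardo_dual n.
Proof.
elim: n => [|n IH]; first exact: gagliardo_dual0.
move=> u h g uh mg g0; have [mu_ u0 mh h0 _] := uh.
set k : R := (n.+2%:R / n.+1%:R)%R.
have k0 : (0 < k)%R by rewrite divr_gt0.
apply: (le_trans (hoelder_ge0 (p := k) (q := n.+2%:R) _ mu_ mg u0 g0 _ _ _)) => //.
  by rewrite /k invf_div -[X in (_ + X)%R]div1r -mulrDl natr1 divff.
apply: lee_pmul; rewrite ?poweR_ge0//.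
  have I0 : 0 <= \int[lebesgue_row n.+2]_x (h x)%:E.
    by apply: integral_ge0 => x _; rewrite lee_fin.
  rewrite -[leRHS]poweRe1// -(mulfV (lt0r_neq0 k0)) poweRrM.
  apply: gt0_ler_poweR; rewrite ?invr_ge0 ?(ltW k0)//.
  - by rewrite in_itv/= leey andbT; apply: integral_ge0 => x _; rewrite lee_fin powR_ge0.
  - by rewrite in_itv/= leey andbT poweR_ge0.
  exact: gagliardo_step.
by under eq_integral do rewrite powR_mulrn//.
Qed.

Theorem gagliardo n (u h : 'rV[R]_n.+2 -> R) : dominated_on_lines u h ->
  \int[lebesgue_row n.+2]_x (u x `^ (n.+2%:R / n.+1%:R))%:E <=
  (\int[lebesgue_row n.+2]_x (h x)%:E) `^ (n.+2%:R / n.+1%:R).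
Proof. by apply: gagliardo_step; exact: gagliardo_dualP. Qed.

End gagliardo.

(** * Hardy's inequality on the ball *)

Section bounded_support.
Context {R : realType}.
Notation mu := (@lebesgue_measure R).

Lemma measurable_prod_coord n (ph : R -> R) : measurable_fun setT ph ->
  measurable_fun setT (fun x : 'rV[R]_n => \prod_i ph (x ord0 i)).
Proof.
move=> mph; apply: (@measurable_prod _ _ _ _ _ (index_enum 'I_n)
  (fun i (x : 'rV[R]_n) => ph (x ord0 i))) => i _.
exact: (measurableT_comp mph (measurable_coord i)).
Qed.

Lemma integral_prod_coord n (ph : R -> R) :
  measurable_fun setT ph -> (forall t, 0 <= ph t) ->
  (\int[lebesgue_row n]_x (\prod_i ph (x ord0 i))%:E =
   (\int[mu]_t (ph t)%:E) ^+ n)%E.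
Proof.
move=> mph ph0; elim: n => [|n IH].
  under eq_integral do rewrite big_ord0.
  by rewrite integral_cst//= diracT mul1e.
have I0 : (0 <= \int[mu]_t (ph t)%:E)%E.
  by apply: integral_ge0 => t _; rewrite lee_fin.
rewrite lebesgue_row_tonelli1; first last.
- by move=> x; rewrite lee_fin prodr_ge0.
- by apply/measurable_EFinP; exact: measurable_prod_coord.
transitivity (\int[mu]_t ((ph t)%:E *
    \int[lebesgue_row n]_y (\prod_i ph (y ord0 i))%:E))%E.
  apply: eq_integral => t _; rewrite -ge0_integralZl//.
  - apply: eq_integral => y _; rewrite -EFinM big_ord_recl row_cons0.
    by congr (_ * _)%:E; apply: eq_bigr => i _; rewrite row_cons_lift.
  - by apply/measurable_EFinP; exact: measurable_prod_coord.
  - by move=> y _; rewrite lee_fin prodr_ge0.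
  - by rewrite lee_fin.
rewrite IH ge0_integralZr//; first last.
- by rewrite expe_ge0.
- by move=> t _; rewrite lee_fin.
- exact/measurable_EFinP.
by rewrite expeS.
Qed.

(** A cube instead of a ball: it contains the unit ball, and its indicator is a product of functions
    of one coordinate, so that [integral_prod_coord] gives its finite volume. *)
Definition box n := [set x : 'rV[R]_n | forall i, `|x ord0 i| <= 1].

Lemma boxE n (x : 'rV[R]_n) :
  \prod_i \1_(`[-1, 1]%classic : set R) (x ord0 i) = \1_(@box n) x :> R.
Proof.
have E i : (x ord0 i \in (`[-1, 1]%classic : set R)) = (`|x ord0 i| <= 1).
  by rewrite ler_norml; apply/idP/idP; rewrite inE /= in_itv.
have [xb|xb] := boolP (x \in @box n).
  rewrite indicE xb big1// => i _; rewrite indicE E.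
  by move: xb; rewrite inE => ->.
rewrite indicE (negbTE xb).
have [i xi] : exists i, ~~ (`|x ord0 i| <= 1).
  by move: xb; rewrite notin_setE => /existsNP[i /negP]; exists i.
by rewrite (bigD1 i)//= indicE E (negbTE xi) mul0r.
Qed.

Lemma integral_boxed_lty n (g : 'rV[R]_n -> R) (M : R) :
  measurable_fun setT g -> (forall x, 0 <= g x <= M) ->
  (forall x, g x != 0 -> box x) ->
  (\int[lebesgue_row n]_x (g x)%:E < +oo)%E.
Proof.
move=> mg gM gb.
pose b := fun x : 'rV[R]_n => (\prod_i \1_(`[-1, 1]%classic : set R) (x ord0 i) : R).
have mI : measurable_fun setT (\1_(`[-1, 1]%classic : set R) : R -> R).
  exact: measurable_indic.
have mb : measurable_fun setT (EFin \o b).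
  by apply/measurable_EFinP; apply: measurable_prod_coord.
have b0 x : (0 <= (b x)%:E)%E by rewrite lee_fin prodr_ge0.
have M0 : 0 <= M by have /andP[h1 h2] := gM 0; exact: le_trans h1 h2.
apply: (@le_lt_trans _ _ (\int[lebesgue_row n]_x (M%:E * (b x)%:E))%E).
  apply: ge0_le_integral => //.
  - by move=> x _; rewrite lee_fin; have /andP[] := gM x.
  - exact/measurable_EFinP.
  - exact: measurable_funeM.
  move=> x _; rewrite -EFinM lee_fin /b boxE.
  have [->|gx] := eqVneq (g x) 0; first by rewrite mulr_ge0.
  rewrite indicE mem_set ?mulr1; last exact: gb.
  by have /andP[] := gM x.
rewrite ge0_integralZl// integral_prod_coord//.
rewrite integral_indic// setIT.
have fin : mu (`[(-1)%R, 1%R]%classic : set R) \is a fin_num.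
  by rewrite lebesgue_measure_itv/=; case: ifP.
by move/fineK: fin => fin; rewrite -[X in (X ^+ n)%E]fin -EFin_expe -EFinM ltry.
Qed.

Lemma continuous_box_bounded n (f : 'rV[R]_n -> R) : continuous f ->
  exists2 M, 0 <= M & forall x, box x -> `|f x| <= M.
Proof.
move=> cf.
have cb : compact (@box n).
  rewrite (_ : @box n =
      [set v : 'rV[R]_n | forall i, v ord0 i \in `[(-1 : R), (1 : R)]]).
    apply: (@rV_compact _ _ (fun=> `[(-1 : R), (1 : R)]%classic)).
    by move=> _; exact: segment_compact.
  by apply/seteqP; split=> x /= h i; have := h i; rewrite ler_norml in_itv.
have : compact (f @` @box n).
  by apply: continuous_compact => //; exact: continuous_subspaceT.
move=> /compact_bounded[M [_ hM]].
exists (`|M| + 1); first by rewrite addr_ge0.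
move=> x bx; apply: hM; last by exists x.
by rewrite (le_lt_trans (ler_norm _))// ltrDl.
Qed.

End bounded_support.

Section ball_estimates.
Context {R : realType}.
Notation mu := (@lebesgue_measure R).

(* The absolute value only matters outside the ball, where every function of
   interest vanishes. *)
Definition bweight n (x : 'rV[R]_n) : R := `|1 - enorm x ^+ 2|^-1.
Definition gradnorm n (f : 'rV[R]_n -> R) (x : 'rV[R]_n) : R := enorm (egrad f x).

Lemma bweight_ge0 n (x : 'rV[R]_n) : 0 <= bweight x.
Proof. by rewrite invr_ge0. Qed.

Lemma gradnorm_ge0 n f (x : 'rV[R]_n) : 0 <= gradnorm f x.
Proof. exact: enorm_ge0. Qed.

Lemma le_partial_gradnorm n (f : 'rV[R]_n -> R) x i :
  `|partial i f x| <= gradnorm f x.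
Proof. by have := le_coord_enorm (egrad f x) i; rewrite mxE. Qed.

Lemma measurable_bweight n : measurable_fun setT (@bweight n).
Proof.
rewrite (_ : @bweight n = fun x => `|1 - enorm x ^+ 2| `^ (-1)).
  apply: (measurableT_comp (measurable_powR _)).
  apply: measurableT_comp => //; apply: measurable_funB => //.
  by apply: measurable_funX; exact: measurable_enorm.
by apply/funext => x; rewrite powR_inv1.
Qed.

Lemma unit_ballP n (x : 'rV[R]_n) : unit_ball x -> 0 < 1 - enorm x ^+ 2.
Proof. by move=> x1; rewrite subr_gt0 expr_lt1// enorm_ge0. Qed.

Lemma bweightE n (x : 'rV[R]_n) : unit_ball x ->
  bweight x = (1 - enorm x ^+ 2)^-1.
Proof. by move=> /unit_ballP x1; rewrite /bweight gtr0_norm. Qed.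

Section c1.
Variables (n : nat) (f : 'rV[R]_n -> R) (r : R).
Hypothesis fr : c1_ball f r.

Lemma measurable_c1 : measurable_fun setT f.
Proof. exact: (continuous_measurable_row (c1_continuous fr)). Qed.

Lemma measurable_partial i : measurable_fun setT (partial i f).
Proof. exact: (continuous_measurable_row (@c1_partial _ _ _ _ fr i)). Qed.

Lemma measurable_gradnorm : measurable_fun setT (gradnorm f).
Proof.
apply: (measurableT_comp (measurable_enorm (R:=R) (n:=n))).
apply/measurable_fun_rowP => i.
rewrite (_ : (fun _ => _) = partial i f); first exact: measurable_partial.
by apply/funext => x; rewrite mxE.
Qed.

Lemma c1_zero x : ~ unit_ball x -> f x = 0 /\ forall i, partial i f x = 0.
Proof.
move=> /negP; rewrite -leNgt => x1; apply: (c1_support fr).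
exact: le_trans (ltW (c1_lt1 fr)) x1.
Qed.

Lemma c1_bounded : exists2 M, 0 <= M & forall x, `|f x| * bweight x <= M.
Proof.
have [M M0 fM] := continuous_box_bounded (c1_continuous fr).
have r2 : 0 < 1 - r ^+ 2.
  by rewrite subr_gt0 expr_lt1 ?(c1_lt1 fr) ?(c1_ge0 fr).
exists (M / (1 - r ^+ 2)); first by rewrite divr_ge0// ltW.
move=> x; have [xr|xr] := leP r (enorm x).
  by have [-> _] := c1_support fr xr; rewrite normr0 mul0r divr_ge0// ltW.
have x1 : unit_ball x by exact: lt_trans xr (c1_lt1 fr).
apply: ler_pM => //; rewrite ?bweight_ge0//.
  by apply: fM => i; apply: le_trans (le_coord_enorm x i) _; exact: ltW.
rewrite bweightE// lef_pV2 ?posrE// ?unit_ballP//.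
by rewrite lerD2l lerN2 ler_pXn2r ?nnegrE ?enorm_ge0 ?(c1_ge0 fr)// ltW.
Qed.

End c1.

End ball_estimates.

(** Either 2Kb <= c, and half of c^(m+1) suffices, or c < 2Kb, and c is replaced by 2Kb. The
    coefficient 1/2 is what allows absorption into the left side of Hardy's inequality. *)
Lemma young_absorb {R : realFieldType} (c b K : R) m : 0 <= c -> 0 <= b -> 0 < K ->
  K * (c ^+ m * b) <= c ^+ m.+1 / 2 + K * (2 * K) ^+ m * b ^+ m.+1.
Proof.
move=> c0 b0 K0; have [bc|cb] := leP (2 * K * b) c.
  apply: (@le_trans _ _ (c ^+ m.+1 / 2)); last first.
    by rewrite lerDl !mulr_ge0 ?exprn_ge0 ?mulr_ge0// ltW.
  rewrite exprSr mulrCA -mulrA ler_wpM2l ?exprn_ge0//; lra.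
apply: (@le_trans _ _ (K * (2 * K) ^+ m * b ^+ m.+1)); last first.
  by rewrite lerDr divr_ge0 ?exprn_ge0.
rewrite exprSr -mulrA ler_wpM2l ?(ltW K0)// mulrA ler_wpM2r//.
by rewrite -exprMn; apply: lerXn2r; rewrite ?nnegrE ?mulr_ge0 ?(ltW K0)//; exact: ltW.
Qed.

Section hardy.
Context {R : realType}.
Notation mu := (@lebesgue_measure R).
Variables (k : nat) (f : 'rV[R]_k.+2 -> R) (r : R).
Hypothesis fr : c1_ball f r.
Local Notation n := k.+2.
Local Notation lam := (lebesgue_row k.+2).

Let mf := measurable_c1 fr.
Let mV := @measurable_bweight R n.
Let mD := measurable_gradnorm fr.

(* The two parts of ∂_i (|f|^n x_i w^(1-n)), the second one in absolute value. *)
Let a (i : 'I_n) x := `|f x| ^+ n * (bweight x ^+ k.+1 +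
  2 * k.+1%:R * x ord0 i ^+ 2 * bweight x ^+ n).
Let b (i : 'I_n) x := n%:R * `|f x| ^+ k.+1 * `|partial i f x| * `|x ord0 i| *
  bweight x ^+ k.+1.

Let ma i : measurable_fun setT (a i).
Proof.
apply: measurable_funM.
  by apply: measurable_funX; exact: measurableT_comp.
apply: measurable_funD; first exact: measurable_funX.
apply: measurable_funM; last exact: measurable_funX.
by apply: measurable_funM => //; apply: measurable_funX; exact: measurable_coord.
Qed.

Let mb i : measurable_fun setT (b i).
Proof.
apply: measurable_funM; last exact: measurable_funX.
apply: measurable_funM; last by apply: measurableT_comp => //; exact: measurable_coord.
apply: measurable_funM; last by apply: measurableT_comp => //; exact: (measurable_partial fr).
by apply: measurable_funM => //; apply: measurable_funX; exact: measurableT_comp.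
Qed.

Let a0 i x : 0 <= a i x.
Proof.
have V0 := bweight_ge0 x.
rewrite /a; apply: mulr_ge0; first by rewrite exprn_ge0.
by rewrite addr_ge0 ?exprn_ge0// mulr_ge0 ?exprn_ge0// mulr_ge0 ?sqr_ge0.
Qed.

Let b0 i x : 0 <= b i x.
Proof. by rewrite /b !mulr_ge0 ?exprn_ge0 ?bweight_ge0. Qed.

(** On a line of direction i, the derivative of |f|^n t w^(1-n) is [a] plus a signed term of
    absolute value [b]; it integrates to zero. *)
Let ab i : (\int[lam]_x (a i x)%:E <= \int[lam]_x (b i x)%:E)%E.
Proof.
apply: (le_integral_lines (i := i)).
- exact/measurable_EFinP.
- by move=> x; rewrite lee_fin.
- exact/measurable_EFinP.
- by move=> x; rewrite lee_fin.
move=> x.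
have H := is_derive_id_weight (x := x) (i := i) k.+1.
apply: (line_hardy fr H (a := fun t => a i (upd x i t))
  (b := fun t => b i (upd x i t)) (k := k)).
- exact: (measurableT_comp (ma i) (measurable_upd x i)).
- by [].
- exact: (measurableT_comp (mb i) (measurable_upd x i)).
- by [].
move=> t; rewrite /a /b /line_derive mxE eqxx; set y := upd x i t.
have [y1|y1] := pselect (unit_ball y); last first.
  have [-> ->] := c1_zero fr y1.
  by rewrite normr0 !expr0n/= !(mul0r, mulr0, addr0).
rewrite bweightE//; set V := (_)^-1; have V0 : 0 <= V.
  by rewrite invr_ge0 ltW// unit_ballP.
rewrite -/V addrAC lerDr.
have -> : n%:R * `|f y| ^+ k * f y * partial i f y * (t * V ^+ k.+1) =
   n%:R * `|f y| ^+ k * V ^+ k.+1 * (f y * partial i f y * t) by ring.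
have -> : n%:R * `|f y| ^+ k.+1 * `|partial i f y| * `|t| * V ^+ k.+1 =
   n%:R * `|f y| ^+ k * V ^+ k.+1 * (`|f y * partial i f y * t|).
  by rewrite !normrM exprS; ring.
by rewrite -mulrDr mulr_ge0 ?mulr_ge0 ?exprn_ge0// -lerBlDl sub0r ler_normr lexx orbT.
Qed.

(** With K = n^2, Young's inequality produces K (2K)^(n-1), and moving half of the left side across
    doubles it to (2K)^n. *)
Definition hardy_const : R := (2 * n%:R ^+ 2) ^+ n.

Lemma hardy_integral_lty : (\int[lam]_x ((`|f x| * bweight x) ^+ n)%:E < +oo)%E.
Proof.
have [M M0 fM] := c1_bounded fr.
apply: (integral_boxed_lty (M := M ^+ n)).
- by apply: measurable_funX; apply: measurable_funM => //; exact: measurableT_comp.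
- move=> x; rewrite exprn_ge0 ?mulr_ge0 ?bweight_ge0//=.
  by apply: lerXn2r; rewrite ?nnegrE ?mulr_ge0 ?bweight_ge0.
- move=> x fx i; have [x1|x1] := pselect (unit_ball x).
    by apply: le_trans (le_coord_enorm x i) _; exact: ltW.
  by move: fx; have [-> _] := c1_zero fr x1; rewrite normr0 mul0r expr0n eqxx.
Qed.

Lemma hardy : (\int[lam]_x ((`|f x| * bweight x) ^+ n)%:E <=
  hardy_const%:E * \int[lam]_x (gradnorm f x ^+ n)%:E)%E.
Proof.
set I := (\int[lam]_x ((`|f x| * bweight x) ^+ n)%:E)%E.
set G := (\int[lam]_x (gradnorm f x ^+ n)%:E)%E.
(* One factor n comes from differentiating |f|^n, the other from summing over the n coordinates. *)
pose K : R := n%:R ^+ 2.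
have K0 : 0 < K by rewrite exprn_gt0.
have KK0 : 0 <= K * (2 * K) ^+ k.+1.
  by rewrite ltW// mulr_gt0// exprn_gt0// mulr_gt0.
have mc : measurable_fun setT (fun x => `|f x| * bweight x).
  by apply: measurable_funM => //; exact: measurableT_comp.
have c0 x : 0 <= `|f x| * bweight x by rewrite mulr_ge0 ?bweight_ge0.
have sumab : (\int[lam]_x (\sum_i a i x)%:E <= \int[lam]_x (\sum_i b i x)%:E)%E.
  have E (g : 'I_n -> 'rV[R]_n -> R) : (forall i, measurable_fun setT (g i)) ->
    (forall i x, 0 <= g i x) ->
    (\int[lam]_x (\sum_i g i x)%:E = \sum_i \int[lam]_x (g i x)%:E)%E.
    move=> mg g0; under eq_integral do rewrite -sumEFin.
    apply: (@ge0_integral_sum _ _ _ _ _ measurableT _ (fun i x => (g i x)%:E)).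
      by move=> i; exact/measurable_EFinP.
    by move=> i x _; rewrite lee_fin.
  by rewrite !E//; apply: lee_sum => i _.
have step : (I <= 2^-1%:E * I + (K * (2 * K) ^+ k.+1)%:E * G)%E.
  rewrite /I /G -!ge0_integralZl//; first last.
  - by move=> x _; rewrite lee_fin exprn_ge0.
  - by apply/measurable_EFinP; exact: measurable_funX.
  - by move=> x _; rewrite lee_fin exprn_ge0 ?gradnorm_ge0.
  - by apply/measurable_EFinP; exact: measurable_funX.
  rewrite -ge0_integralD//; first last.
  - by apply: measurable_funeM; apply/measurable_EFinP; exact: measurable_funX.
  - by move=> x _; rewrite -EFinM lee_fin mulr_ge0// exprn_ge0// gradnorm_ge0.
  - by apply: measurable_funeM; apply/measurable_EFinP; exact: measurable_funX.
  - by move=> x _; rewrite -EFinM lee_fin mulr_ge0 ?exprn_ge0.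
  apply: (@le_trans _ _ (\int[lam]_x (\sum_i a i x)%:E)%E).
    apply: ge0_le_integral => //.
    - by move=> x _; rewrite lee_fin exprn_ge0.
    - by apply/measurable_EFinP; exact: measurable_funX.
    - by apply/measurable_EFinP; exact: measurable_sum.
    move=> x _; rewrite lee_fin.
    have [x1|x1] := pselect (unit_ball x); last first.
      have [-> _] := c1_zero fr x1.
      by rewrite normr0 mul0r expr0n/= sumr_ge0.
    rewrite -mulr_sumr exprMn ler_wpM2l ?exprn_ge0//.
    rewrite big_split/= sumr_const card_ord -mulr_suml -mulr_sumr -enorm_sqr.
    have W0 := unit_ballP x1; rewrite bweightE//.
    set e := enorm x ^+ 2; rewrite -/e in W0.
    have e0 : 0 <= e by exact: sqr_ge0.
    set V := (1 - e)^-1; have V0 : 0 < V by rewrite invr_gt0.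
    (* The sum of the [a i] thus becomes |f|^n V^n times n(1-e) + 2(n-1)e = n + (n-2)e, which is at
       least 1. *)
    have -> : V ^+ k.+1 = (1 - e) * V ^+ n by rewrite [in RHS]exprS mulVKf ?gt_eqF.
    rewrite -[_ *+ n in X in X + _]mulr_natl mulrA -mulrDl ler_peMl ?exprn_ge0 ?(ltW V0)//.
    have kk : 0 <= k%:R :> R by [].
    rewrite -[n%:R]/((2 + k)%:R) -[k.+1%:R]/((1 + k)%:R) !natrD; nra.
  apply: (le_trans sumab).
  apply: ge0_le_integral => //.
  - by move=> x _; rewrite lee_fin sumr_ge0.
  - by apply/measurable_EFinP; exact: measurable_sum.
  - by apply: emeasurable_funD; apply: measurable_funeM; apply/measurable_EFinP;
      exact: measurable_funX.
  move=> x _; rewrite -!EFinM -EFinD lee_fin.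
  apply: (@le_trans _ _ (K * ((`|f x| * bweight x) ^+ k.+1 * gradnorm f x))); last first.
    apply: le_trans (young_absorb k.+1 (c0 x) (gradnorm_ge0 f x) K0) _.
    by rewrite [X in X + _]mulrC.
  have -> : K * ((`|f x| * bweight x) ^+ k.+1 * gradnorm f x) =
     \sum_(i < n) n%:R * `|f x| ^+ k.+1 * gradnorm f x * 1 * bweight x ^+ k.+1.
    rewrite sumr_const card_ord -mulr_natl exprMn /K; ring.
  apply: ler_sum => i _; rewrite ler_wpM2r ?exprn_ge0 ?bweight_ge0//.
  have [x1|x1] := pselect (unit_ball x); last first.
    have [-> _] := c1_zero fr x1.
    by rewrite normr0 expr0n/= !(mulr0, mul0r).
  apply: ler_pM; rewrite ?mulr_ge0 ?exprn_ge0//; last first.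
    by apply: le_trans (le_coord_enorm x i) _; exact: ltW.
  by rewrite ler_wpM2l ?mulr_ge0 ?exprn_ge0// le_partial_gradnorm.
have Ifin : I \is a fin_num.
  rewrite ge0_fin_numE; first exact: hardy_integral_lty.
  by apply: integral_ge0 => x _; rewrite lee_fin exprn_ge0.
have := step; rewrite -(fineK Ifin).
have [Goo|] := ltP G +oo%E; last first.
  rewrite leye_eq => /eqP -> _; rewrite gt0_muley ?leey//.
  by rewrite lte_fin exprn_gt0// mulr_gt0.
have Gfin : G \is a fin_num.
  rewrite ge0_fin_numE//.
  by apply: integral_ge0 => x _; rewrite lee_fin exprn_ge0 ?gradnorm_ge0.
have -> : hardy_const = 2 * (K * (2 * K) ^+ k.+1).
  by rewrite /hardy_const -/K [LHS]exprS mulrA.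
by rewrite -(fineK Gfin) -!EFinM -EFinD !lee_fin; set X := K * _; lra.
Qed.

End hardy.

(** * Iterated Sobolev inequality *)

(** According to whether v is at most 1 or larger, one of the two terms alone dominates. *)
Lemma le_powR_interp {R : realType} (v p s t : R) : 0 <= v -> 0 < p -> p <= s -> s <= t ->
  v `^ s <= v `^ p + v `^ t.
Proof.
move=> v0 p0 ps st; have [v1|v1] := leP v 1; last first.
  by rewrite ler_wpDl ?powR_ge0// ler_powR// ltW.
rewrite ler_wpDr ?powR_ge0//.
have [->|vn0] := eqVneq v 0; first by rewrite !powR0 ?gt_eqF// (lt_le_trans p0).
by apply: ger_powR => //; rewrite v1 lt0r vn0 v0.
Qed.

Section sobolev.
Context {R : realType}.
Notation mu := (@lebesgue_measure R).
Variable k : nat.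
Local Notation n := k.+2.
Local Notation lam := (lebesgue_row k.+2).

Definition crit : R := n%:R / k.+1%:R.

Lemma crit_gt0 : 0 < crit. Proof. by rewrite divr_gt0. Qed.

(** [crit] and n are conjugate; the coefficients 1/[crit] and 1/n, both at most 1, are dropped. *)
Lemma young_crude (a b : R) : 0 <= a -> 0 <= b -> a * b <= a `^ crit + b ^+ n.
Proof.
move=> a0 b0.
have conj : crit^-1 + n%:R^-1 = 1 :> R.
  by rewrite /crit invf_div -[X in _ + X]div1r -mulrDl natr1 divff.
apply: le_trans (conjugate_powR a0 b0 crit_gt0 (ltr0Sn _ _) conj) _.
rewrite powR_mulrn//; apply: lerD; last by rewrite ler_pdivrMr// ler_peMr ?exprn_ge0// ler1n.
rewrite ler_pdivrMr ?crit_gt0// ler_peMr ?powR_ge0//.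
by rewrite /crit ler_pdivlMr// mul1r ler_nat.
Qed.

(** The A_s of the overview; for [f] supported in the ball and s > 0, it is 2^(-n) times the
    integral of |f|^s for the hyperbolic volume. *)
Definition mass (f : 'rV[R]_k.+2 -> R) (s : R) : \bar R :=
  (\int[lam]_x (`|f x| `^ s * bweight x ^+ n)%:E)%E.

Definition dirichlet (f : 'rV[R]_k.+2 -> R) : \bar R :=
  (\int[lam]_x (gradnorm f x ^+ n)%:E)%E.

Lemma dirichlet_ge0 f : (0 <= dirichlet f)%E.
Proof. by apply: integral_ge0 => x _; rewrite lee_fin exprn_ge0 ?gradnorm_ge0. Qed.

Lemma mass_ge0 f s : (0 <= mass f s)%E.
Proof.
by apply: integral_ge0 => x _; rewrite lee_fin mulr_ge0 ?powR_ge0 ?exprn_ge0 ?bweight_ge0.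
Qed.

Section step.
Variables (f : 'rV[R]_k.+2 -> R) (r : R).
Hypothesis fr : c1_ball f r.

Let mf : measurable_fun setT (fun x => `|f x|).
Proof. by apply: measurableT_comp => //; exact: (measurable_c1 fr). Qed.
Let mV := @measurable_bweight R n.
Let mD := measurable_gradnorm fr.
Let V0 x := @bweight_ge0 R n x.
Let D0 x := @gradnorm_ge0 R n f x.

Lemma measurable_mass s : measurable_fun setT (fun x => `|f x| `^ s * bweight x ^+ n).
Proof.
apply: measurable_funM; last exact: measurable_funX.
exact: (measurableT_comp (measurable_powR _) mf).
Qed.

Lemma mass_interp (p s t : R) : 0 < p -> p <= s -> s <= t ->
  (mass f s <= mass f p + mass f t)%E.
Proof.
move=> p0 ps st; rewrite /mass -ge0_integralD//; first last.
- by apply/measurable_EFinP; exact: measurable_mass.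
- by move=> x _; rewrite lee_fin mulr_ge0 ?powR_ge0 ?exprn_ge0.
- by apply/measurable_EFinP; exact: measurable_mass.
- by move=> x _; rewrite lee_fin mulr_ge0 ?powR_ge0 ?exprn_ge0.
apply: ge0_le_integral => //.
- by move=> x _; rewrite lee_fin mulr_ge0 ?powR_ge0 ?exprn_ge0.
- by apply/measurable_EFinP; exact: measurable_mass.
- by apply: emeasurable_funD; apply/measurable_EFinP; exact: measurable_mass.
move=> x _; rewrite -EFinD lee_fin -mulrDl ler_wpM2r ?exprn_ge0//.
exact: le_powR_interp.
Qed.

Section exponent.
Variable j : nat.
Let u x := `|f x| ^+ j.+2 * bweight x ^+ k.+1.
(** A bound on the derivative of [u] common to all directions: each partial derivative of [f] is
    bounded by [gradnorm f], and each coordinate by 1. *)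
Let h x := j.+2%:R * (`|f x| ^+ j.+1 * bweight x ^+ k.+1 * gradnorm f x) +
  2 * k.+1%:R * (`|f x| ^+ j.+2 * bweight x ^+ n).

Let dom : dominated_on_lines u h.
Proof.
split.
- by apply: measurable_funM; exact: measurable_funX.
- by move=> x; rewrite mulr_ge0 ?exprn_ge0.
- apply: measurable_funD; apply: measurable_funM => //; apply: measurable_funM => //;
    try exact: measurable_funX.
  by apply: measurable_funM; exact: measurable_funX.
- move=> x; rewrite addr_ge0//; first by rewrite !mulr_ge0 ?exprn_ge0.
  by rewrite mulr_ge0// mulr_ge0 ?exprn_ge0.
move=> i x.
have H := is_derive_weight (x := x) (i := i) k.+1.
have := line_sobolev fr j H (x ord0 i).
rewrite /line_fun upd_self => /le_trans L.
have -> : u x = `| `|f x| ^+ j.+2 * (1 - enorm x ^+ 2)^-1 ^+ k.+1 |.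
  by rewrite normrM !normrX normr_id normfV.
apply: L; apply: ge0_le_integral => //.
- apply/measurable_EFinP; apply: measurableT_comp => //.
  exact: (measurable_line_derive fr j H).
- apply/measurable_EFinP; apply: measurableT_comp (measurable_upd x i).
  rewrite /h; apply: measurable_funD; apply: measurable_funM => //; apply: measurable_funM => //;
    try exact: measurable_funX.
  by apply: measurable_funM; exact: measurable_funX.
move=> t _; rewrite lee_fin /line_derive; set y := upd x i t.
have [y1|y1] := pselect (unit_ball y); last first.
  have [-> _] := c1_zero fr y1.
  by rewrite /h (c1_zero fr y1).1 normr0 !expr0n/= !(mul0r, mulr0, addr0) normr0.
have W0 := unit_ballP y1; set V := (1 - enorm y ^+ 2)^-1.
have Vy : V = bweight y by rewrite bweightE.
have Vp : 0 <= V by rewrite Vy.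
have t1 : `|t| <= 1.
  have := le_coord_enorm y i; rewrite mxE eqxx => /le_trans; apply; exact: ltW.
apply: le_trans (ler_normD _ _) _; rewrite /h -Vy; apply: lerD.
  rewrite !normrM !normrX !normr_id (ger0_norm (ler0n _ _)) (ger0_norm Vp).
  have -> : j.+2%:R * `|f y| ^+ j * `|f y| * `|partial i f y| * V ^+ k.+1 =
    j.+2%:R * (`|f y| ^+ j.+1 * V ^+ k.+1 * `|partial i f y|) by rewrite (exprSr _ j); ring.
  by rewrite ler_wpM2l// ler_wpM2l ?mulr_ge0 ?exprn_ge0// le_partial_gradnorm.
rewrite normrM (ger0_norm (exprn_ge0 _ (normr_ge0 _))) normrM.
have -> : `|2 * t| = 2 * `|t| by rewrite normrM ger0_norm.
rewrite [`|_ * V ^+ n|]ger0_norm; last by rewrite mulr_ge0// exprn_ge0.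
have -> : `|f y| ^+ j.+2 * (k.+1%:R * V ^+ n * (2 * `|t|)) =
  2 * k.+1%:R * (`|f y| ^+ j.+2 * V ^+ n) * `|t| by ring.
by rewrite ler_piMr// mulr_ge0// mulr_ge0// exprn_ge0.
Qed.

(** Since [crit] times n-1 is n, raising w^(1-n) to the power [crit] gives w^(-n) both in u^[crit]
    and, after Young's inequality, in the gradient term. Every integral is thus again a [mass] with
    the same weight. *)
Lemma sobolev_step : (mass f (crit * j.+2%:R) <=
  (j.+2%:R%:E * (mass f (crit * j.+1%:R) + dirichlet f) +
   (2 * k.+1%:R)%:E * mass f j.+2%:R) `^ crit)%E.
Proof.
have uE x : u x `^ crit = `|f x| `^ (crit * j.+2%:R) * bweight x ^+ n.
  rewrite /u powRM ?exprn_ge0//; congr (_ * _).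
    by rewrite -powR_mulrn// -powRrM mulrC.
  by rewrite -!powR_mulrn// -powRrM; congr (_ `^ _); rewrite /crit mulrC divfK.
have := gagliardo dom.
under eq_integral do rewrite -/crit uE.
move=> /le_trans; apply; apply: gt0_ler_poweR; first exact: ltW crit_gt0.
- by rewrite in_itv/= leey andbT; apply: integral_ge0 => x _; rewrite lee_fin; case: dom.
- rewrite in_itv/= leey andbT adde_ge0// mule_ge0 ?lee_fin//.
    by rewrite adde_ge0 ?mass_ge0 ?dirichlet_ge0.
  by rewrite mass_ge0.
rewrite /mass /dirichlet -ge0_integralD//; first last.
- by apply/measurable_EFinP; exact: measurable_funX.
- by move=> x _; rewrite lee_fin exprn_ge0.
- by apply/measurable_EFinP; exact: measurable_mass.
- by move=> x _; rewrite lee_fin mulr_ge0 ?powR_ge0 ?exprn_ge0.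
have mp (s : R) : measurable_fun setT (fun x => (`|f x| `^ s * bweight x ^+ n)%:E).
  by apply/measurable_EFinP; exact: measurable_mass.
have mG : measurable_fun setT (fun x => (gradnorm f x ^+ n)%:E).
  by apply/measurable_EFinP; exact: measurable_funX.
have p0 (s : R) x : (0 <= (`|f x| `^ s * bweight x ^+ n)%:E)%E.
  by rewrite lee_fin mulr_ge0 ?powR_ge0 ?exprn_ge0.
have G0 x : (0 <= (gradnorm f x ^+ n)%:E)%E by rewrite lee_fin exprn_ge0.
rewrite -!ge0_integralZl//; first last.
- by move=> x _; exact: adde_ge0.
- exact: emeasurable_funD.
rewrite -ge0_integralD//; first last.
- exact: measurable_funeM.
- by move=> x _; apply: mule_ge0; [rewrite lee_fin|exact: p0].
- by apply: measurable_funeM; exact: emeasurable_funD.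
- by move=> x _; apply: mule_ge0; [rewrite lee_fin|exact: adde_ge0].
apply: ge0_le_integral => //.
- by move=> x _; rewrite lee_fin; case: dom.
- by apply/measurable_EFinP; case: dom.
- apply: emeasurable_funD; apply: measurable_funeM => //.
  exact: emeasurable_funD.
move=> x _; rewrite [leRHS](_ : _ = (j.+2%:R * (`|f x| `^ (crit * j.+1%:R) * bweight x ^+ n + gradnorm f x ^+ n) + 2 * k.+1%:R * (`|f x| `^ j.+2%:R * bweight x ^+ n))%:E)// lee_fin /h; apply: lerD; last first.
  by rewrite powR_mulrn.
rewrite ler_wpM2l//; apply: le_trans (young_crude _ _) _; rewrite ?mulr_ge0 ?exprn_ge0//.
rewrite lerD2r le_eqVlt; apply/orP; left; apply/eqP.
rewrite powRM ?exprn_ge0//; congr (_ * _).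
  by rewrite -powR_mulrn// -powRrM mulrC.
by rewrite -!powR_mulrn// -powRrM; congr (_ `^ _); rewrite /crit mulrC divfK.
Qed.

End exponent.
End step.

(** The ladder starts at the index k+1 because [crit] times k+1 is n, where Hardy's inequality
    applies. Each [sobolev_step] raises the index by one. *)
Lemma crit_iterate j : exists2 C : R, 0 <= C & forall f r, c1_ball f r ->
  (dirichlet f <= 1)%E -> (mass f (crit * (k.+1 + j)%:R) <= C%:E)%E.
Proof.
have baseH f r : c1_ball f r -> (dirichlet f <= 1)%E ->
    (mass f n%:R <= (@hardy_const R k)%:E)%E.
  move=> fr G1; have := hardy fr.
  under eq_integral do rewrite exprMn -powR_mulrn//.
  move=> /le_trans; apply; rewrite -[leRHS]mule1 lee_wpmul2l//.
  by rewrite lee_fin exprn_ge0// mulr_ge0 ?exprn_ge0.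
elim: j => [|j [C C0 IH]].
  exists (@hardy_const R k); first by rewrite exprn_ge0// mulr_ge0 ?exprn_ge0.
  by move=> f r fr G1; rewrite addn0 /crit divfK//; exact: baseH fr G1.
pose H := @hardy_const R k.
have H0 : 0 <= H by rewrite exprn_ge0// mulr_ge0 ?exprn_ge0.
exists ((((k + j).+2%:R * (C + 1) + 2 * k.+1%:R * (H + C)) `^ crit)).
  exact: powR_ge0.
move=> f r fr G1; have := sobolev_step fr (k + j).
rewrite (_ : (k.+1 + j.+1)%N = (k + j).+2); last by lia.
move=> /le_trans; apply; rewrite -poweR_EFin.
have mC : (mass f (crit * (k + j).+1%:R) <= C%:E)%E by exact: IH fr G1.
apply: gt0_ler_poweR; first exact: ltW crit_gt0.
- rewrite in_itv/= leey andbT adde_ge0// mule_ge0 ?lee_fin ?mass_ge0//.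
  by rewrite adde_ge0 ?mass_ge0 ?dirichlet_ge0.
- rewrite in_itv/= leey andbT lee_fin; apply: addr_ge0; first by rewrite mulr_ge0// addr_ge0.
  by rewrite mulr_ge0// addr_ge0.
rewrite [leRHS]EFinD; apply: leeD; rewrite [leRHS]EFinM; apply: lee_wpmul2l; rewrite ?lee_fin//.
  by rewrite [leRHS]EFinD; apply: leeD.
(* The exponent k+j+2 is not on the ladder; it lies between n and the rung already reached, so the
   two known bounds control it. *)
rewrite [leRHS]EFinD; apply: (@le_trans _ _ (mass f n%:R + mass f (crit * (k + j).+1%:R))%E).
  apply: (mass_interp fr) => //; first by rewrite ler_nat; lia.
  rewrite /crit mulrAC ler_pdivlMr// -!natrM ler_nat; nia.
by apply: leeD => //; exact: baseH fr G1.
Qed.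

Theorem sobolev_ball s : n%:R <= s -> exists2 C : R, 0 <= C & forall f r,
  c1_ball f r -> (dirichlet f <= 1)%E -> (mass f s <= C%:E)%E.
Proof.
move=> ns.
have [j sj] : exists j, s <= crit * (k.+1 + j)%:R.
  (* The rung of index j is n + [crit] j, which exceeds j because [crit] > 1. *)
  exists (Num.bound s); apply: (@le_trans _ _ (Num.bound s)%:R).
    by rewrite ltW// archi_boundP// (le_trans _ ns).
  rewrite /crit mulrAC ler_pdivlMr// -!natrM ler_nat; nia.
have [C C0 hC] := crit_iterate j; have [C' C'0 hC'] := crit_iterate 0.
exists (C' + C); first by rewrite addr_ge0.
move=> f r fr G1; rewrite EFinD.
apply: le_trans (mass_interp fr (p := n%:R) _ ns sj) _ => //.
apply: leeD; last exact: hC fr G1.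
by have := hC' f r fr G1; rewrite addn0 /crit divfK.
Qed.

End sobolev.

(** * The hyperbolic volume *)

Section density.
Local Open Scope ereal_scope.
Context d (T : measurableType d) (R : realType).
Variables (mu nu : {measure set T -> \bar R}) (B : set T) (p : T -> R).
Hypotheses (mB : measurable B) (mp : measurable_fun B p).
Hypothesis p0 : forall x, B x -> (0 <= p x)%R.
Hypothesis nuE : forall A, measurable A -> nu A = \int[mu]_(x in A `&` B) (p x)%:E.

Import HBNNSimple.

Let mpE : measurable_fun B (EFin \o p).
Proof. exact/measurable_EFinP. Qed.

Let indicE' (E : set T) : measurable E ->
  \int[nu]_x (\1_E x)%:E = \int[mu]_(x in B) ((\1_E x)%:E * (p x)%:E).
Proof.
move=> mE; rewrite integral_indic// setIT nuE// setIC integral_mkcondr.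
apply: eq_integral => x _; rewrite epatch_indic /=.
by rewrite muleC.
Qed.

Let nnsfunE (h : {nnsfun T >-> R}) :
  \int[nu]_x (h x)%:E = \int[mu]_(x in B) ((h x)%:E * (p x)%:E).
Proof.
under [LHS]eq_integral do rewrite fimfunE -fsumEFin//.
rewrite [LHS]ge0_integral_fsum//; last 2 first.
  - by move=> r; exact/measurable_EFinP/measurableT_comp.
  - by move=> n x _; rewrite EFinM nnfun_muleindic_ge0.
have hE x : (h x)%:E * (p x)%:E =
    \sum_(r \in range h) (r * \1_(h @^-1` [set r]) x)%:E * (p x)%:E.
  rewrite fimfunE -fsumEFin//.
  apply: ge0_mule_fsuml => r.
  by rewrite EFinM; exact: nnfun_muleindic_ge0.
under [RHS]eq_integral do rewrite hE.
rewrite [RHS]ge0_integral_fsum//; last 2 first.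
  - move=> r; apply: emeasurable_funM => //.
    by apply/measurable_EFinP; apply: measurable_funTS; exact/measurableT_comp.
  - move=> s x Bx; apply: mule_ge0; last by rewrite lee_fin p0.
    by rewrite EFinM; exact: nnfun_muleindic_ge0.
apply: eq_fsbigr => r _.
rewrite integralZl_indic_nnsfun// indicE'//.
(* Membership of r in the range has been dropped; a negative r has an empty level set, so both sides
   vanish. *)
have [r0|r0] := ltP r 0%R.
  have E : h @^-1` [set r] = set0 by exact: preimage_nnfun0.
  rewrite E; under eq_integral do rewrite indicE in_set0 mul0e.
  by under [RHS]eq_integral do rewrite indicE in_set0 mulr0 mul0e; rewrite !integral0 mule0.
rewrite -ge0_integralZl//.
- by apply: eq_integral => x _; rewrite EFinM muleA.
- apply: emeasurable_funM => //; apply/measurable_EFinP; exact: measurable_funTS.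
- by move=> x Bx; rewrite mule_ge0// lee_fin ?p0.
Qed.

(** [nuE] only gives measures of sets, so the formula is extended from indicators to simple
    functions and then by monotone limits. *)
Lemma ge0_integral_density (g : T -> \bar R) :
  measurable_fun setT g -> (forall x, 0 <= g x) ->
  \int[nu]_x g x = \int[mu]_(x in B) (g x * (p x)%:E).
Proof.
move=> mg g0; pose f_ := nnsfun_approx measurableT mg.
have fg x : (f_ n x)%:E @[n --> \oo] --> g x by exact: cvg_nnsfun_approx.
have ndf x : {homo (fun n => (f_ n x)%:E) : a b / (a <= b)%N >-> a <= b}.
  by move=> a b ab; rewrite lee_fin; exact/lefP/nd_nnsfun_approx.
transitivity (limn (fun n => \int[nu]_x (f_ n x)%:E)).
  rewrite -monotone_convergence//=.
  - by apply: eq_integral => x _; apply/esym/cvg_lim.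
  - by move=> n; apply/measurable_EFinP.
  - by move=> n x _; rewrite lee_fin.
transitivity (limn (fun n => \int[mu]_(x in B) ((f_ n x)%:E * (p x)%:E))).
  by congr (limn _); apply/funext => n; exact: nnsfunE.
rewrite -monotone_convergence//=.
- apply: eq_integral => x _; apply/cvg_lim => //.
  by apply: cvgeZr.
- move=> n; apply: emeasurable_funM => //.
  by apply/measurable_EFinP; exact: measurable_funTS.
- by move=> n x Bx; rewrite mule_ge0// lee_fin ?p0.
- by move=> x Bx a b ab; rewrite lee_wpmul2r ?lee_fin ?p0//; exact: ndf.
Qed.

End density.

Section hvolume.
Context {R : realType} {n : nat}.
Local Open Scope ereal_scope.

Lemma integral_hvolume (g : 'rV[R]_n -> \bar R) :
  measurable_fun setT g -> (forall x, 0 <= g x) ->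
  \int[hvolume R n]_x g x =
  \int[lebesgue_row n]_(x in unit_ball) (g x * (hdensity x)%:E).
Proof.
apply: ge0_integral_density => //.
- exact: measurable_unit_ball.
- exact: measurable_hdensity.
- by move=> x; exact: hdensity_ge0.
Qed.

Lemma hdensityE (x : 'rV[R]_n) : unit_ball x ->
  hdensity x = (2 ^+ n * bweight x ^+ n)%R.
Proof. by move=> x1; rewrite /hdensity bweightE// exprVn. Qed.

Lemma hlengthE (x v : 'rV[R]_n) : unit_ball x ->
  hlength x v = (2 * bweight x * enorm v)%R.
Proof.
move=> x1; rewrite /hlength /hmetric bweightE//.
have W0 := unit_ballP x1; set W := (1 - _)%R in W0 *.
under eq_bigr do rewrite -expr2; rewrite -enorm_sqr.
have -> : (4 / W ^+ 2 * enorm v ^+ 2 = (2 / W * enorm v) ^+ 2)%R.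
  by field; rewrite gt_eqF.
by rewrite sqrtr_sqr ger0_norm// !mulr_ge0 ?enorm_ge0// invr_ge0 ltW.
Qed.

Lemma enormZ (a : R) (v : 'rV[R]_n) : (0 <= a)%R -> enorm (a *: v) = (a * enorm v)%R.
Proof.
move=> a0; rewrite /enorm.
under eq_bigr do rewrite mxE exprMn.
by rewrite -mulr_sumr sqrtrM ?sqr_ge0// sqrtr_sqr ger0_norm.
Qed.

Lemma hlength_hgrad (f : 'rV[R]_n -> R) x : unit_ball x ->
  hlength x (hgrad f x) = ((1 - enorm x ^+ 2) / 2 * gradnorm f x)%R.
Proof.
move=> x1; rewrite hlengthE// bweightE// /hgrad.
have W0 := unit_ballP x1; set W := (1 - _)%R in W0 *.
rewrite enormZ ?divr_ge0 ?sqr_ge0// /gradnorm.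
by field; rewrite gt_eqF.
Qed.

(** Conformal invariance of the n-energy: the factor (w/2)^n from the length cancels the density
    (2/w)^n. *)
Lemma hlength_hgrad_density (f : 'rV[R]_n -> R) x : unit_ball x ->
  (hlength x (hgrad f x) ^+ n * hdensity x = gradnorm f x ^+ n)%R.
Proof.
move=> x1; rewrite hlength_hgrad// hdensityE// -!exprMn bweightE//; congr (_ ^+ _)%R.
by have W0 := unit_ballP x1; field; rewrite gt_eqF.
Qed.

Lemma measurable_hlength (F : 'rV[R]_n -> 'rV[R]_n) : measurable_fun setT F ->
  measurable_fun setT (fun x => hlength x (F x)).
Proof.
move=> mF; rewrite /hlength; apply: (measurableT_comp
  (continuous_measurable_fun (@sqrt_continuous R))).
apply: measurable_funM.
  rewrite (_ : (fun _ => _) = fun x : 'rV[R]_n => (4 * bweight x ^+ 2)%R).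
    by apply: measurable_funM => //; apply: measurable_funX; exact: measurable_bweight.
  by apply/funext => x; rewrite /bweight exprVn real_normK ?num_real.
apply: measurable_sum => i; rewrite (_ : (fun _ => _) = fun x => (F x ord0 i ^+ 2)%R)//.
apply: measurable_funX.
by have /measurable_fun_rowP := mF; exact.
Qed.

Lemma hlength_ge0 (x v : 'rV[R]_n) : (0 <= hlength x v)%R.
Proof. exact: sqrtr_ge0. Qed.

Lemma measurable_hrho : measurable_fun setT (@hrho R n).
Proof.
rewrite /hrho; apply: (measurableT_comp (@measurable_ln R)).
apply: measurable_funM.
  by apply: measurable_funD => //; exact: measurable_enorm.
have mi : measurable_fun setT (fun y : R => y^-1)%R.
  rewrite (_ : (fun _ => _) = fun y : R => (y * (`|y| ^+ 2) `^ (-1))%R).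
    apply: measurable_funM => //; apply: (measurableT_comp (measurable_powR _)).
    by apply: measurable_funX; exact: normr_measurable.
  apply/funext => y; have [->|y0] := eqVneq y 0%R; first by rewrite invr0 mul0r.
  by rewrite powR_inv1 ?exprn_ge0// real_normK ?num_real//; field.
apply: (measurableT_comp mi).
by apply: measurable_funB => //; exact: measurable_enorm.
Qed.

Lemma measurable_hrho_powRV (b : R) :
  measurable_fun setT (fun x : 'rV[R]_n => (hrho x `^ b)^-1)%R.
Proof.
rewrite (_ : (fun _ => _) = fun x : 'rV[R]_n => hrho x `^ (- b))%R.
  exact: (measurableT_comp (measurable_powR _) measurable_hrho).
by apply/funext => x; rewrite powRN.
Qed.

Lemma ln_ge_1subV (y : R) : (0 < y -> 1 - y^-1 <= ln y)%R.
Proof.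
move=> y0; have : (ln (1 + (y^-1 - 1)) <= y^-1 - 1)%R.
  by apply: le_ln1Dx; rewrite ltrBrDl addrN invr_gt0.
by rewrite addrCA subrr addr0 lnV ?posrE//; lra.
Qed.

(** With y = (1+s)/(1-s), the bound ln y >= 1 - 1/y gives 2s/(1+s), which is at least s since s <
    1. *)
Lemma enorm_le_hrho (x : 'rV[R]_n) : unit_ball x -> (enorm x <= hrho x)%R.
Proof.
move=> x1; rewrite /hrho; set s := enorm x; have s0 : (0 <= s)%R by exact: enorm_ge0.
have s1 : (s < 1)%R by exact: x1.
have y0 : (0 < (1 + s) / (1 - s))%R by rewrite divr_gt0; lra.
apply: le_trans (ln_ge_1subV y0).
have -> : (1 - ((1 + s) / (1 - s))^-1 = 2 * s / (1 + s))%R.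
  by field; rewrite !gt_eqF//; lra.
by rewrite ler_pdivlMr; nra.
Qed.

Lemma hrho_ge0 (x : 'rV[R]_n) : (0 <= hrho x)%R.
Proof.
have [x1|x1] := pselect (unit_ball x).
  exact: le_trans (enorm_ge0 x) (enorm_le_hrho x1).
(* Outside the ball the quotient is nonpositive (zero on the sphere, by the convention on division),
   and [ln] has default value 0 there. *)
rewrite /hrho ln0//.
have {}x1 : (1 <= enorm x)%R by rewrite leNgt; apply/negP.
by rewrite mulr_ge0_le0 ?addr_ge0 ?enorm_ge0// invr_le0 subr_le0.
Qed.

End hvolume.

(** * The singular weight *)

Section singular_weight.
Context {R : realType}.
Notation mu := (@lebesgue_measure R).
Implicit Types (a s : R).

Lemma integral_powRN_itv a (e : R) : a < 1 -> 0 < e -> e < 1 ->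
  (\int[mu]_(s in `[e, 1%R]) (s `^ (- a))%:E <= ((1 - a)^-1)%:E)%E.
Proof.
move=> a1 e0 e1; pose F s := s `^ (1 - a) / (1 - a).
have a1n : 1 - a != 0 by rewrite gt_eqF// subr_gt0.
have dF s : 0 < s -> is_derive s 1 F (s `^ (- a)).
  move=> s0; have := is_deriveM (is_derive1_powR (1 - a) s0)
    (is_derive_cst ((1 - a)^-1 : R^o) (s : R^o) 1).
  move=> /is_derive_eq; apply; rewrite scaler0 add0r /cst /GRing.scale/=.
  by rewrite (_ : 1 - a - 1 = - a); [field|ring].
have cF s : 0 < s -> {for s, continuous F}.
  move=> s0; apply: differentiable_continuous; apply/derivable1_diffP.
  by have [] := dF s s0.
rewrite (@continuous_FTC2 R (fun s => s `^ (- a)) F)//.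
- rewrite -EFinB lee_fin /F powR1 -mulrBl ler_pdivrMr ?subr_gt0//.
  by rewrite mulVf// lerBlDr lerDl powR_ge0.
- apply: derivable_within_continuous => s; rewrite in_itv/= => /andP[es _].
  by apply: derivable_powR; rewrite in_itv/= andbT (lt_le_trans e0).
- split => [s||].
  + rewrite in_itv/= => /andP[es _].
    by have [] := dF s (lt_trans e0 es).
  + by apply: cvg_at_right_filter; exact: cF.
  + by apply: cvg_at_left_filter; exact: cF.
- move=> s; rewrite in_itv/= => /andP[es _].
  by rewrite derive1E; have [_ ->] := dF s (lt_trans e0 es).
Qed.

Lemma measurable_powRN a : measurable_fun setT (fun s : R => (s `^ (- a))%:E).
Proof. by apply/measurable_EFinP; exact: measurable_powR. Qed.

Lemma integral_powRN_01 a : a < 1 ->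
  (\int[mu]_(s in `]0%R, 1%R]) (s `^ (- a))%:E <= ((1 - a)^-1)%:E)%E.
Proof.
(* Starting from 1/2 keeps the left endpoint strictly below 1, as [integral_powRN_itv] requires; its
   bound does not depend on that endpoint. *)
move=> a1; pose F (j : nat) := `[j.+2%:R^-1, 1%R]%classic : set R.
have -> : `]0%R, 1%R]%classic = \bigcup_j F j.
  apply/seteqP; split=> [s|s [j _]]; rewrite /F /= !in_itv/=.
    move=> /andP[s0 s1]; exists (Num.bound s^-1) => //=.
    rewrite in_itv/= s1 andbT invf_ple ?posrE//.
    have sV : 0 <= s^-1 by rewrite invr_ge0 ltW.
    apply: (le_trans (ltW (archi_boundP sV))).
    by rewrite ler_nat; do 2 apply: ltnW.
  by move=> /andP[js ->]; rewrite andbT (lt_le_trans _ js).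
have ndF : nondecreasing_seq F.
  move=> i j ij; apply/subsetPset => s; rewrite /F /= !in_itv/= => /andP[h ->].
  by rewrite andbT (le_trans _ h)// lef_pV2 ?posrE// ler_nat !ltnS.
have cvgF : (\int[mu]_(s in F j) (s `^ (- a))%:E @[j --> \oo] -->
    \int[mu]_(s in \bigcup_j F j) (s `^ (- a))%:E)%E.
  apply: ge0_nondecreasing_set_cvg_integral => //.
  - by move=> j; exact: measurable_itv.
  - by move=> j; apply: measurable_funTS; exact: measurable_powRN.
  - by move=> j s _; rewrite lee_fin powR_ge0.
rewrite -(cvg_lim _ cvgF)//; apply: lime_le; first by apply/cvg_ex; eexists; exact: cvgF.
apply: nearW => j; apply: integral_powRN_itv => //.
by rewrite invf_lt1// ltr1n.
Qed.

(** The cut-off makes the singular power integrable on R for a < 1, while the product over the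
    coordinates still dominates a power of |x| on the ball. *)
Definition sing a s : R := \1_(`[(-1)%R, 1%R]%classic : set R) s * `|s| `^ (- a).

Lemma sing_ge0 a s : 0 <= sing a s.
Proof. by rewrite mulr_ge0 ?powR_ge0. Qed.

Lemma measurable_sing a : measurable_fun setT (sing a).
Proof.
apply: measurable_funM; first exact: measurable_indic.
by apply: (measurableT_comp (measurable_powR _)); exact: normr_measurable.
Qed.

Lemma integral_sing_lty a : a < 1 -> (\int[mu]_s (sing a s)%:E < +oo)%E.
Proof.
move=> a1.
have mS : measurable_fun setT (fun s => (sing a s)%:E).
  by apply/measurable_EFinP; exact: measurable_sing.
have S0 s : (0 <= (sing a s)%:E)%E by rewrite lee_fin sing_ge0.
have pos : (\int[mu]_(s in `[0%R, +oo[) (sing a s)%:E < +oo)%E.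
  rewrite -integral_itv_obnd_cbnd; last exact: measurable_funTS.
  apply: (@le_lt_trans _ _ (\int[mu]_(s in `]0%R, 1%R]) (s `^ (- a))%:E)%E).
    rewrite [leLHS]integral_mkcond [leRHS]integral_mkcond.
    apply: ge0_le_integral => //.
    - by move=> s _; rewrite patchE; case: ifP.
    - exact: (proj1 (measurable_restrictT _ _) (measurable_funTS mS)).
    - exact: (proj1 (measurable_restrictT _ _) (measurable_funTS (measurable_powRN a))).
    move=> s _; rewrite !patchE; case: ifPn => [|_]; last first.
      by case: ifP => _; rewrite // lee_fin powR_ge0.
    rewrite inE/= in_itv/= andbT => s0; rewrite /sing indicE.
    have -> : (s \in (`[(-1)%R, 1%R]%classic : set R)) = (s <= 1).
      apply/idP/idP => [|s1]; rewrite inE/= in_itv/=; first by case/andP.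
      by rewrite s1 andbT; lra.
    have -> : (s \in (`]0%R, 1%R]%classic : set R)) = (s <= 1).
      by apply/idP/idP => [|s1]; rewrite inE/= in_itv/= s0.
    by case: ifP => _; rewrite ?mul1r ?mul0r// gtr0_norm.
  by apply: le_lt_trans (integral_powRN_01 a1) _; rewrite ltry.
have -> : [set: R] = `[0%R, +oo[%classic `|` `]-oo, 0%R[%classic.
  apply/seteqP; split=> // s _; rewrite /= !in_itv/= andbT.
  by have [|] := leP 0 s; [left|right].
rewrite ge0_integral_setU//=; first last.
- apply/disj_setPS => s [] /=; rewrite !in_itv/= andbT => s0 s1.
  by move: (lt_le_trans s1 s0); rewrite ltxx.
- exact: measurable_funTS.
rewrite lte_add_pinfty//; apply: le_lt_trans pos.
(* The negative half-line is reflected onto the positive one, [sing a] being even. *)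
rewrite (ge0_integration_by_substitution0 mS)//.
under [leRHS]eq_integral => s _.
  have -> : sing a (- s) = sing a s.
    rewrite /sing normrN; congr (_ * _); rewrite !indicE.
    have E (y : R) : (y \in (`[(-1)%R, 1%R]%classic : set R)) = (`|y| <= 1).
      by rewrite ler_norml; apply/idP/idP; rewrite inE /= in_itv.
    by rewrite !E normrN.
  over.
apply: ge0_subset_integral => //; first exact: measurable_funTS.
by move=> s /=; rewrite !in_itv/= => /ltW.
Qed.

(** A line of direction i meets the hyperplane x_i = 0 in a single point, a null set, and
    [le_integral_lines] concludes. *)
Lemma ae_coord_neq0 n : {ae lebesgue_row n, forall x : 'rV[R]_n, forall i, x ord0 i != 0}.
Proof.
apply: filter_forall => i.
have m0 : measurable [set x : 'rV[R]_n | x ord0 i = 0].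
  rewrite (_ : [set x | _] = (fun x : 'rV[R]_n => x ord0 i) @^-1` [set 0])//.
  rewrite -[X in measurable X]setTI.
  by apply: measurable_coord => //; exact: measurable_set1.
exists [set x : 'rV[R]_n | x ord0 i = 0]; split=> //; last first.
  by move=> x /= /negP; rewrite negbK => /eqP.
apply/eqP; rewrite eq_le measure_ge0 andbT.
pose N : set 'rV[R]_n := [set x | x ord0 i = 0].
rewrite -[X in (X <= _)%E](_ : (\int[lebesgue_row n]_x (\1_N x)%:E)%E = _); last first.
  by rewrite integral_indic// setIT.
rewrite -(integral0 (lebesgue_row n) setT).
apply: (le_integral_lines (i := i)) => //.
- by apply/measurable_EFinP; exact: measurable_indic.
move=> x; rewrite integral0.
have E : (\int[mu]_t (\1_N (upd x i t))%:E =
    \int[mu]_t (\1_([set 0] : set R) t)%:E)%E.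
  apply: eq_integral => t _; rewrite !indicE; congr ((nat_of_bool _)%:R)%:E.
  by apply/idP/idP; rewrite !inE /N /= mxE eqxx.
by rewrite E integral_indic//= setIT lebesgue_measure_set1.
Qed.

End singular_weight.

(** Young's inequality with the exponents g/(g-b) and g/b, obtained by comparing v with y^(g-b);
    this also covers b = 0. *)
Lemma le_mul_powR_split {R : realType} (v y b g : R) : 0 <= v -> 0 < y -> 0 <= b -> b < g ->
  v * y `^ b <= v `^ (g / (g - b)) + y `^ g.
Proof.
move=> v0 y0 b0 bg; have d0 : 0 < g - b by rewrite subr_gt0.
have yn : y != 0 by rewrite gt_eqF.
have [vy|yv] := leP v (y `^ (g - b)).
  rewrite ler_wpDl ?powR_ge0//.
  rewrite [leRHS](_ : _ = y `^ (g - b) * y `^ b); first by rewrite ler_wpM2r ?powR_ge0.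
  by rewrite -powRD ?yn ?implybT// subrK.
rewrite ler_wpDr ?powR_ge0//.
have v1 : 0 < v by apply: le_lt_trans yv; exact: powR_ge0.
have -> : g / (g - b) = 1 + b / (g - b).
  by field; rewrite gt_eqF.
rewrite powRD; last by rewrite (gt_eqF v1) implybT.
rewrite powRr1// ler_wpM2l//.
have -> : y `^ b = (y `^ (g - b)) `^ (b / (g - b)).
  by rewrite -powRrM mulrC divfK// gt_eqF.
by apply: ge0_ler_powR; rewrite ?nnegrE ?powR_ge0 ?divr_ge0// ltW.
Qed.

(** * The weighted inequality for C^1 functions of normalised energy *)

Section weighted.
Context {R : realType}.
Variable k : nat.
Local Notation n := k.+2.
Local Notation lam := (lebesgue_row k.+2).

(** The q-th power of the left-hand norm of the first inequality, for q > 0. *)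
Definition wmass (beta q : R) (f : 'rV[R]_k.+2 -> R) : \bar R :=
  (\int[hvolume R k.+2]_x (`|f x| `^ q * (hrho x `^ beta)^-1)%:E)%E.

Lemma measurable_wmass (beta q : R) (f : 'rV[R]_k.+2 -> R) : measurable_fun setT f ->
  measurable_fun setT (fun x => (`|f x| `^ q * (hrho x `^ beta)^-1)%:E).
Proof.
move=> mf; apply/measurable_EFinP; apply: measurable_funM.
  by apply: (measurableT_comp (measurable_powR _)); exact: measurableT_comp.
exact: measurable_hrho_powRV.
Qed.

(* The coordinates have to be nonzero because 0 `^ (- a) = 0. *)
Lemma enorm_powR_le_prod (x : 'rV[R]_k.+2) (g : R) : 0 < g -> unit_ball x ->
  (forall i, x ord0 i != 0) ->
  enorm x `^ (- g) <= \prod_i sing (g / n%:R) (x ord0 i).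
Proof.
move=> g0 x1 xn0.
have xpos : 0 < enorm x.
  by apply: lt_le_trans (le_coord_enorm x ord0); rewrite normr_gt0.
have -> : enorm x `^ (- g) = \prod_(i < n) enorm x `^ (- (g / n%:R)).
  rewrite prodr_const card_ord -powR_mulrn ?powR_ge0// -powRrM mulNr divfK//.
apply: ler_prod => i _; rewrite powR_ge0/=.
have xi : `|x ord0 i| <= 1.
  by apply: le_trans (le_coord_enorm x i) _; exact: ltW.
rewrite /sing indicE mem_set/=; last by rewrite in_itv/= -ler_norml.
rewrite mul1r !powRN lef_pV2 ?posrE ?powR_gt0 ?normr_gt0//.
by apply: ge0_ler_powR; rewrite ?nnegrE ?divr_ge0 ?enorm_ge0 ?le_coord_enorm// ltW.
Qed.

Theorem weighted_c1 (beta q : R) : 0 <= beta -> beta < n%:R -> n%:R <= q ->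
  exists2 C : R, 0 <= C & forall f r, c1_ball f r ->
    (dirichlet f <= 1)%E -> (wmass beta q f <= C%:E)%E.
Proof.
move=> b0 bn nq.
(* Any value strictly between beta and n would do: g > beta for the splitting, g/n < 1 for
   integrability in each coordinate. *)
pose g : R := (beta + n%:R) / 2.
have n0 : 0 < n%:R :> R by [].
have bg : beta < g by rewrite /g; lra.
have gn : g < n%:R by rewrite /g; lra.
have g0 : 0 < g by exact: le_lt_trans bg.
(* The exponent of |f| when [le_mul_powR_split] is applied to v = |f|^q and y = 1/|x|. *)
pose t : R := q * (g / (g - beta)).
have q0 : 0 < q by exact: lt_le_trans nq.
have nt : n%:R <= t.
  apply: (le_trans nq); rewrite /t ler_peMr ?(ltW q0)//.
  by rewrite ler_pdivlMr ?subr_gt0// mul1r lerBlDr lerDl.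
have [Cq Cq0 hq] := @sobolev_ball R k q nq.
have [Ct Ct0 ht] := @sobolev_ball R k t nt.
pose I : \bar R := (\int[lam]_x (\prod_i sing (g / n%:R) (x ord0 i))%:E)%E.
have I0 : (0 <= I)%E.
  by apply: integral_ge0 => x _; rewrite lee_fin prodr_ge0// => i _; exact: sing_ge0.
have Ifin : I \is a fin_num.
  rewrite /I integral_prod_coord; [|exact: measurable_sing|exact: sing_ge0].
  have : (\int[lebesgue_measure]_s (sing (g / n%:R) s)%:E \is a fin_num)%E.
    rewrite ge0_fin_numE; last by apply: integral_ge0 => s _; rewrite lee_fin sing_ge0.
    by apply: integral_sing_lty; rewrite ltr_pdivrMr// mul1r.
  by move=> /fineK <-; rewrite -EFin_expe.
(* [c1] serves |x| >= 1/2, where the singular weight is at most 2^beta. [c2] and [c3] serve |x| <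
   1/2, where 1/w <= 2 bounds the density in front of |x|^(-g) by 2^n 2^n. *)
pose c1 : R := 2 ^+ n * 2 `^ beta.
pose c2 : R := 2 ^+ n.
pose c3 : R := 2 ^+ n * 2 ^+ n.
have c10 : 0 <= c1 by rewrite mulr_ge0 ?powR_ge0// exprn_ge0.
have c20 : 0 <= c2 by rewrite exprn_ge0.
have c30 : 0 <= c3 by rewrite mulr_ge0// exprn_ge0.
exists (c1 * Cq + (c2 * Ct + c3 * fine I)).
  by apply: addr_ge0; last apply: addr_ge0; apply: mulr_ge0 => //; exact: fine_ge0.
move=> f r fr G1.
have V0 (x : 'rV[R]_n) := bweight_ge0 x.
pose A s (x : 'rV[R]_n) : \bar R := (`|f x| `^ s * bweight x ^+ n)%:E.
pose P (x : 'rV[R]_n) : \bar R := (\prod_i sing (g / n%:R) (x ord0 i))%:E.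
have A0 s x : (0 <= A s x)%E by rewrite lee_fin mulr_ge0 ?powR_ge0// exprn_ge0.
have mA s : measurable_fun setT (A s) by apply/measurable_EFinP; exact: (measurable_mass fr).
have P0 x : (0 <= P x)%E by rewrite lee_fin prodr_ge0// => i _; exact: sing_ge0.
have mP : measurable_fun setT P.
  by apply/measurable_EFinP; apply: measurable_prod_coord; exact: measurable_sing.
pose W x : \bar R := (`|f x| `^ q * (hrho x `^ beta)^-1)%:E.
have W0 x : (0 <= W x)%E by rewrite lee_fin mulr_ge0 ?invr_ge0 ?powR_ge0.
have mW : measurable_fun setT W.
  exact: (measurable_wmass _ _ (measurable_c1 fr)).
rewrite /wmass integral_hvolume//.
pose B x := (c1%:E * A q x + (c2%:E * A t x + c3%:E * P x))%E.
have B0 x : (0 <= B x)%E.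
  by apply: adde_ge0; last apply: adde_ge0; apply: mule_ge0.
have mB : measurable_fun setT B.
  by apply: emeasurable_funD; last apply: emeasurable_funD; exact: measurable_funeM.
apply: (@le_trans _ _ (\int[lam]_x B x)%E); last first.
  rewrite ge0_integralD//; first last.
  - by apply: emeasurable_funD; exact: measurable_funeM.
  - by move=> x _; apply: adde_ge0; apply: mule_ge0.
  - exact: measurable_funeM.
  - by move=> x _; apply: mule_ge0.
  rewrite ge0_integralD//; first last.
  - exact: measurable_funeM.
  - by move=> x _; apply: mule_ge0.
  - exact: measurable_funeM.
  - by move=> x _; apply: mule_ge0.
  rewrite !ge0_integralZl//.
  rewrite [leRHS]EFinD; apply: leeD.
    by rewrite [leRHS]EFinM; apply: lee_wpmul2l; rewrite ?lee_fin//; exact: (hq f r).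
  rewrite [leRHS]EFinD; apply: leeD.
    by rewrite [leRHS]EFinM; apply: lee_wpmul2l; rewrite ?lee_fin//; exact: (ht f r).
  by rewrite [leRHS]EFinM fineK.
apply: (@le_trans _ _ (\int[lam]_(x in unit_ball) B x)%E); last first.
  apply: ge0_subset_integral => //; exact: measurable_unit_ball.
apply: ae_ge0_le_integral => //.
- exact: measurable_unit_ball.
- by move=> x x1; apply: mule_ge0; [exact: W0|rewrite lee_fin hdensity_ge0].
- apply: emeasurable_funM; first exact: measurable_funTS.
  by apply/measurable_EFinP; exact: measurable_hdensity.
- exact: measurable_funTS.
apply: filterS (ae_coord_neq0 (R := R) n) => x xn0 x1.
rewrite hdensityE// /W /B /A /P.
set v := `|f x| `^ q; have v0 : 0 <= v by exact: powR_ge0.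
set V := bweight x; have Vx : 0 <= V by exact: V0.
set p := \prod_i _; have p0 : 0 <= p.
  by rewrite prodr_ge0// => i _; exact: sing_ge0.
rewrite [leRHS](_ : _ =
  (c1 * (v * V ^+ n) + (c2 * (`|f x| `^ t * V ^+ n) + c3 * p))%:E)//.
rewrite -EFinM lee_fin.
have xpos : 0 < enorm x.
  by apply: lt_le_trans (le_coord_enorm x ord0); rewrite normr_gt0.
have rx : (hrho x `^ beta)^-1 <= (enorm x)^-1 `^ beta.
  rewrite -[(enorm x)^-1]powR_inv1 ?enorm_ge0// -powRrM mulN1r powRN.
  rewrite lef_pV2 ?posrE ?powR_gt0//; last exact: lt_le_trans (enorm_le_hrho x1).
  by apply: ge0_ler_powR; rewrite ?nnegrE ?enorm_ge0 ?hrho_ge0// enorm_le_hrho.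
have c20' : 0 <= c2 * V ^+ n by rewrite mulr_ge0// exprn_ge0.
apply: (@le_trans _ _ (v * (enorm x)^-1 `^ beta * (c2 * V ^+ n))).
  by rewrite ler_wpM2r// ler_wpM2l.
have [xh|xh] := leP (2^-1) (enorm x).
  have h : (enorm x)^-1 `^ beta <= 2 `^ beta.
    apply: ge0_ler_powR; rewrite ?nnegrE ?invr_ge0 ?enorm_ge0//.
    by rewrite invf_ple ?posrE.
  apply: (@le_trans _ _ (c1 * (v * V ^+ n))).
    rewrite /c1 -/c2 (_ : c2 * 2 `^ beta * (v * V ^+ n) = v * 2 `^ beta * (c2 * V ^+ n)).
      by rewrite ler_wpM2r// ler_wpM2l.
    by ring.
  rewrite lerDl; apply: addr_ge0; apply: mulr_ge0 => //.
  by apply: mulr_ge0; [exact: powR_ge0|exact: exprn_ge0].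
apply: (@le_trans _ _ (c2 * (`|f x| `^ t * V ^+ n) + c3 * p)); last first.
  by rewrite lerDr mulr_ge0// mulr_ge0// exprn_ge0.
have yi : 0 < (enorm x)^-1 by rewrite invr_gt0.
have := le_mul_powR_split v0 yi b0 bg.
rewrite /v -powRrM -/t -/v => h.
apply: (@le_trans _ _ ((`|f x| `^ t + (enorm x)^-1 `^ g) * (c2 * V ^+ n))).
  by rewrite ler_wpM2r.
rewrite mulrDl; apply: lerD; first by rewrite le_eqVlt; apply/orP; left; apply/eqP; ring.
have V2 : V <= 2.
  rewrite /V bweightE// invf_ple ?posrE ?unit_ballP// .
  have : enorm x ^+ 2 <= 2^-1 ^+ 2.
    by apply: lerXn2r; rewrite ?nnegrE ?enorm_ge0// ltW.
  by lra.
have Vn : V ^+ n <= 2 ^+ n by apply: lerXn2r; rewrite ?nnegrE.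
have yp : (enorm x)^-1 `^ g <= p.
  rewrite -[(enorm x)^-1]powR_inv1 ?enorm_ge0// -powRrM mulN1r.
  exact: enorm_powR_le_prod.
apply: (@le_trans _ _ (p * (c2 * V ^+ n))); first by rewrite ler_wpM2r.
by rewrite mulrC ler_wpM2r// /c3 -/c2 ler_wpM2l.
Qed.

End weighted.

(** * Passing to the completion *)

Section fatou_along_subsequence.
Context d (T : measurableType d) (R : realType).
Variable mu : {measure set T -> \bar R}.
Local Open Scope ereal_scope.

Lemma limn_einf_ge (u : (\bar R)^nat) l : (forall k, l <= u k) -> l <= limn_einf u.
Proof.
move=> ul; rewrite limn_einf_lim; apply: lime_ge; first exact: is_cvg_einfs.
by apply: nearW => k; apply: le_ereal_inf_tmp => _ [m _ <-].
Qed.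

Lemma limn_einf_le (u : (\bar R)^nat) l : (forall k, u k <= l) -> limn_einf u <= l.
Proof.
move=> ul; rewrite limn_einf_lim; apply: lime_le; first exact: is_cvg_einfs.
apply: nearW => k; apply: le_trans (ul k); apply: ereal_inf_lbound.
by exists k => /=.
Qed.

(** The sum of the integrals is finite, so the series of the |u_j|^(m+1) converges almost everywhere
    and its terms, bounded by its tails, tend to 0. *)
Lemma ae_cvg_of_summable (u : nat -> T -> R) m :
  (forall j, measurable_fun setT (u j)) ->
  (forall j, \int[mu]_x (`|u j x| ^+ m.+1)%:E <= (1 / (2 ^ (j + 1))%:R)%:E) ->
  {ae mu, forall x, u j x @[j --> \oo] --> (0 : R)%R}.
Proof.
move=> mu_ hu; pose v j x : \bar R := (`|u j x| ^+ m.+1)%:E.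
have v0 j x : 0 <= v j x by rewrite lee_fin exprn_ge0.
have mv j : measurable_fun setT (v j).
  by apply/measurable_EFinP; apply: measurable_funX; exact: measurableT_comp.
pose S x := \sum_(0 <= j <oo) v j x.
have S0 x : 0 <= S x by apply: nneseries_ge0 => j _ _.
have mS : measurable_fun setT S by apply: ge0_emeasurable_sum.
have iS : mu.-integrable setT S.
  apply/integrableP; split=> //.
  under eq_integral do rewrite gee0_abs//.
  rewrite integral_nneseries//.
  apply: (@le_lt_trans _ _ (\sum_(0 <= j <oo) (1 / (2 ^ (j + 1))%:R)%:E)).
    by apply: lee_nneseries => j _; [move=> _; exact: integral_ge0|exact: hu].
  by rewrite (cvg_lim _ (@cvg_geometric_eseries_half R 1%R 0))// ltry.
apply: filterS (integrable_ae measurableT iS) => x /= /(_ I) Sfin.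
apply/cvgrPdist_lt => /= e e0.
have tail : \sum_(N <= j <oo) v j x @[N --> \oo] --> 0.
  by apply: nneseries_tail_cvg => //; rewrite ltey_eq Sfin.
move/fine_cvgP : tail => [tfin t0].
have en : (0 < e ^+ m.+1)%R by rewrite exprn_gt0.
have tlt := cvgr_lt _ t0 _ en.
near=> N.
have h1 : (fine (\sum_(N <= j <oo) v j x) < e ^+ m.+1)%R by near: N; exact: tlt.
have h2 : \sum_(N <= j <oo) v j x \is a fin_num by near: N.
rewrite sub0r normrN -(@ltr_pXn2r _ m.+1)// ?nnegrE ?(ltW e0)//.
rewrite -lte_fin; apply: le_lt_trans (_ : _ < (e ^+ m.+1)%:E); last first.
  by move: h1; rewrite -lte_fin (fineK h2); exact.
apply: (@le_trans _ _ (\sum_(N <= j < N.+1) v j x)); first by rewrite big_nat1.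
exact: nneseries_lim_ge.
Unshelve. all: by end_near. Qed.

Lemma continuous_powR_gt0 (q a : R) : (0 < a)%R -> {for a, continuous (fun y : R => y `^ q)%R}.
Proof.
move=> a0; apply: differentiable_continuous; apply/derivable1_diffP.
by apply: derivable_powR; rewrite in_itv/= a0.
Qed.

(** A subsequence with geometrically small L^(m+1) distances converges almost everywhere. The
    exponent m+1 of the convergence is unrelated to q, the exponent of the estimate. *)
Lemma fatou_Lp (phi : nat -> T -> R) (f w : T -> R) (q : R) m (B : \bar R) :
  (0 < q)%R ->
  (forall k, measurable_fun setT (phi k)) -> measurable_fun setT f ->
  measurable_fun setT w -> (forall x, 0 <= w x)%R ->
  (forall e : R, (0 < e)%R -> exists N, forall k, (N <= k)%N ->
    \int[mu]_x (`|phi k x - f x| ^+ m.+1)%:E <= e%:E) ->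
  (exists N, forall k, (N <= k)%N -> \int[mu]_x (`|phi k x| `^ q * w x)%:E <= B) ->
  \int[mu]_x (`|f x| `^ q * w x)%:E <= B.
Proof.
move=> q0 mphi mf mw w0 cv [N0 hB].
have /choice[s hs] : forall j : nat, exists k, (N0 <= k)%N /\
    \int[mu]_x (`|phi k x - f x| ^+ m.+1)%:E <= (1 / (2 ^ (j + 1))%:R)%:E.
  move=> j; have [|N hN] := cv (1 / (2 ^ (j + 1))%:R)%R.
    by rewrite divr_gt0// ltr0n expn_gt0.
  by exists (maxn N N0); split; [exact: leq_maxr|apply: hN; exact: leq_maxl].
have mW (g : T -> R) : measurable_fun setT g ->
    measurable_fun setT (fun x => (`|g x| `^ q * w x)%:E).
  move=> mg; apply/measurable_EFinP; apply: measurable_funM => //.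
  apply: (measurableT_comp (measurable_powR _)); exact: measurableT_comp.
have W0 (g : T -> R) x : 0 <= (`|g x| `^ q * w x)%:E.
  by rewrite lee_fin mulr_ge0// powR_ge0.
have mu_ j : measurable_fun setT (fun x => phi (s j) x - f x)%R.
  exact: measurable_funB.
have ae := @ae_cvg_of_summable _ m mu_ (fun j => (hs j).2).
apply: (@le_trans _ _ (\int[mu]_x limn_einf (fun j => (`|phi (s j) x| `^ q * w x)%:E))).
  apply: ae_ge0_le_integral => //.
  - exact: mW.
  - by move=> x _; apply: limn_einf_ge.
  - pose g j x := (`|phi (s j) x| `^ q * w x)%:E.
    apply: (emeasurable_fun_cvg (fun k x => einfs (g ^~ x) k)) => [k|x _].
      by apply: measurable_fun_einfs => j; exact: mW.
    by rewrite limn_einf_lim; exact: is_cvg_einfs.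
  apply: filterS ae => x cvx _.
  (* Continuity of y^q is only available at y > 0; where [f x] = 0 the left side is 0 and the
     inequality is trivial. *)
  have [fx|fx] := eqVneq (f x) 0%R.
    by rewrite fx normr0 powR0 ?gt_eqF// mul0r; exact: limn_einf_ge.
  have cph : phi (s j) x @[j --> \oo] --> f x.
    rewrite -[f x]add0r; apply: (cvg_trans _ (cvgD cvx (cvg_cst (f x)))).
    by apply: near_eq_cvg; near=> j; rewrite /= subrK.
  suff : (`|phi (s j) x| `^ q * w x)%:E @[j --> \oo] --> (`|f x| `^ q * w x)%:E.
    by move=> /cvg_limn_einf_sup[-> _].
  apply: cvg_EFin; first exact: nearW.
  apply: cvgM; last exact: cvg_cst.
  apply: (cvg_comp (fun j => `|phi (s j) x|%R) (fun y : R => y `^ q)%R).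
    exact: (cvg_norm cph).
  by apply: continuous_powR_gt0; rewrite normr_gt0.
apply: le_trans (fatou _ _ _ _) _ => //.
  by move=> j; exact: mW.
by apply: limn_einf_le => j; apply: hB; exact: (hs j).1.
Unshelve. all: by end_near. Qed.

End fatou_along_subsequence.

(** * From test functions to C^1 functions supported away from the sphere *)

Section test_functions.
Context {R : realType} {n : nat}.

Lemma continuous_sum_sqr : continuous (fun x : 'rV[R]_n => \sum_i x ord0 i ^+ 2).
Proof.
move=> x.
have H i : (fun y : 'rV[R]_n => y ord0 i ^+ 2) @ x --> x ord0 i ^+ 2.
  have h : continuous (fun y : 'rV[R]_n => y ord0 i) by exact: coord_continuous.
  exact: (cvg_pow _ (h x)).
rewrite /continuous_at.
have FF : Filter (nbhs x) := nbhs_filter (x : 'rV[R]_n).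
elim: (index_enum _) => [|i s IH].
  have -> : (fun y : 'rV[R]_n => \sum_(j <- [::]) y ord0 j ^+ 2) = cst 0.
    by apply/funext => y; rewrite big_nil.
  by rewrite big_nil; exact: cvg_cst.
have -> : (fun y : 'rV[R]_n => \sum_(j <- i :: s) y ord0 j ^+ 2) =
    fun y => y ord0 i ^+ 2 + \sum_(j <- s) y ord0 j ^+ 2.
  by apply/funext => y; rewrite big_cons.
rewrite big_cons; exact: (cvgD (H i) IH).
Qed.

Lemma continuous_enorm : continuous (@enorm R n).
Proof.
by move=> x; exact: (continuous_comp (@continuous_sum_sqr x) (@sqrt_continuous R _)).
Qed.

(** 1/(1-|x|) is continuous on the compact support, hence bounded there, which keeps the support
    away from the sphere. *)
Lemma test_function_c1 (f : 'rV[R]_n -> R) : test_function f -> exists r, c1_ball f r.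
Proof.
move=> [sf cK Kball]; set K := closure _ in cK Kball.
have cinv : {within K, continuous (fun x => (1 - enorm x)^-1)}.
  apply: continuous_in_subspaceT => x; rewrite inE => /Kball x1.
  have FF : Filter (nbhs x) := nbhs_filter (x : 'rV[R]_n).
  have w0 : 1 - enorm x != 0 by rewrite gt_eqF// subr_gt0.
  have ce : (fun y : 'rV[R]_n => 1 - enorm y) @ x --> 1 - enorm x.
    exact: (cvgB (cvg_cst _) (@continuous_enorm x)).
  exact: (cvgV w0 ce).
have [M [_ hM]] := compact_bounded (continuous_compact cinv cK).
pose M' := `|M| + 1.
have KM x : K x -> (1 - enorm x)^-1 <= M'.
  move=> Kx; apply: le_trans (ler_norm _) _; apply: (hM M'); last by exists x.
  by rewrite (le_lt_trans (ler_norm _))// ltrDl.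
have M1 : 1 <= M' by rewrite lerDr.
(* If |x| >= r inside the ball, then 1/(1-|x|) is at least M'+1, strictly above its bound M' on the
   support. *)
pose r : R := 1 - (M' + 1)^-1.
have notK x : r <= enorm x -> ~ K x.
  move=> rx Kx; have x1 : 0 < 1 - enorm x by rewrite subr_gt0; exact: Kball.
  have := KM x Kx; apply/negP; rewrite -ltNge.
  apply: (@lt_le_trans _ _ (M' + 1)); first by rewrite ltrDl.
  rewrite -[leLHS]invrK lef_pV2 ?posrE ?invr_gt0//; last by lra.
  by move: rx; rewrite /r; lra.
exists r; split.
- by rewrite /r subr_ge0 invf_le1; lra.
- by rewrite /r ltrBlDr ltrDl invr_gt0; lra.
- exact: (sf [::]).1.
- exact: (sf [::]).2.
- by move=> i; exact: (sf [:: i]).1.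
move=> x /notK Kx.
(* The complement of the closed support is open, so [f] vanishes near x and its partial derivatives
   at x vanish too. *)
have nz : \forall y \near x, 0 = f y.
  have oK : open (~` K) by apply: closed_openC; exact: closed_closure.
  have : \forall y \near x, (~` K) y by exact: open_nbhs_nbhs.
  apply: filterS => y Ky; apply: contrapT => fy; apply: Ky.
  by apply: subset_closure => /=; apply/eqP => fy0; apply: fy.
split; first by rewrite -(nbhs_singleton nz).
move=> i; rewrite /partial -(near_eq_derive (f := cst 0) _ nz).
exact: derive_cst.
Qed.

Lemma c1_ballZ (a : R) (f : 'rV[R]_n -> R) r : c1_ball f r ->
  c1_ball (fun x => a * f x) r /\
  forall i x, partial i (fun x => a * f x) x = a * partial i f x.
Proof.
move=> [r0 r1 cf df cdf f0].
have pE i x : partial i (fun x => a * f x) x = a * partial i f x.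
  exact: (deriveZ a (df i x)).
have cM (g : 'rV[R]_n -> R) : continuous g -> continuous (fun x => a * g x).
  move=> cg x; have FF : Filter (nbhs x) := nbhs_filter (x : 'rV[R]_n).
  exact: (cvgM (cvg_cst a) (cg x)).
split; last exact: pE.
apply: C1Ball; [exact: r0|exact: r1|exact: cM|..].
- move=> i x.
  exact: (@derivableZ R 'rV[R]_n R f a x (delta_mx ord0 i) (df i x)).
- move=> i; have -> : partial i (fun x => a * f x) = fun x => a * partial i f x.
    by apply/funext => x; exact: pE.
  by apply: cM; exact: cdf.
- move=> x /f0[fx0 px0]; split; first by rewrite fx0 mulr0.
  by move=> i; rewrite pE px0 mulr0.
Qed.

End test_functions.

Section homogeneity.
Context {R : realType}.
Variable k : nat.
Local Notation n := k.+2.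

(** Applies [weighted_c1] to G^(-1/n) f. Scaling by a positive upper bound G of the energy, not by
    the energy itself, avoids a separate case of zero energy. *)
Lemma weighted_c1_homogeneous (beta q : R) : 0 <= beta -> beta < n%:R -> n%:R <= q ->
  exists2 C : R, 0 <= C & forall (f : 'rV[R]_k.+2 -> R) r (G : R), c1_ball f r -> 0 < G ->
    (dirichlet f <= G%:E)%E -> (wmass beta q f <= (C * G `^ (q / n%:R))%:E)%E.
Proof.
move=> b0 bn nq; have [C C0 hC] := @weighted_c1 R k beta q b0 bn nq.
exists C => // f r G fr G0 DG.
pose a : R := G `^ (- n%:R^-1).
have a0 : 0 < a by exact: powR_gt0.
have [afr ap] := c1_ballZ a fr.
have dira : (dirichlet (fun x => (a * f x)%R) = (a ^+ n)%:E * dirichlet f)%E.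
  rewrite /dirichlet -ge0_integralZl//; first last.
  - by rewrite lee_fin exprn_ge0// ltW.
  - by move=> x _; rewrite lee_fin exprn_ge0// gradnorm_ge0.
  - by apply/measurable_EFinP; apply: measurable_funX; exact: (measurable_gradnorm fr).
  apply: eq_integral => x _; rewrite -EFinM -exprMn; congr ((_ ^+ _)%:E).
  rewrite /gradnorm -enormZ ?(ltW a0)//; congr enorm.
  by apply/rowP => i; rewrite !mxE ap.
have massa : (wmass beta q (fun x => (a * f x)%R) = (a `^ q)%:E * wmass beta q f)%E.
  rewrite /wmass -ge0_integralZl//; first last.
  - by rewrite lee_fin powR_ge0.
  - by move=> x _; rewrite lee_fin mulr_ge0 ?invr_ge0 ?powR_ge0.
  - exact: (measurable_wmass _ _ (measurable_c1 fr)).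
  apply: eq_integral => x _; rewrite -EFinM; congr (_%:E).
  by rewrite normrM (gtr0_norm a0) powRM ?(ltW a0)// mulrA.
have := hC _ _ afr; rewrite massa dira => h.
have aq : a `^ q * G `^ (q / n%:R) = 1.
  rewrite /a -powRrM mulNr powRN [q / _]mulrC mulVf//.
  by rewrite gt_eqF// powR_gt0.
have {}h : ((a `^ q)%:E * wmass beta q f <= C%:E)%E.
  apply: h; apply: (@le_trans _ _ ((a ^+ n)%:E * G%:E)%E).
    by apply: lee_wpmul2l => //; rewrite lee_fin exprn_ge0// ltW.
  rewrite -EFinM lee_fin /a -powR_mulrn ?powR_ge0// -powRrM mulNr mulVf//.
  by rewrite powRN powRr1 ?(ltW G0)// mulVf// gt_eqF.
have -> : wmass beta q f = ((a `^ q)%:E * wmass beta q f * (G `^ (q / n%:R))%:E)%E.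
  by rewrite muleAC -EFinM aq mul1e.
rewrite [leRHS]EFinM.
by apply: lee_wpmul2r => //; rewrite lee_fin powR_ge0.
Qed.

End homogeneity.

(** * The weighted inequality on the completion *)

Section completion.
Context {R : realType}.
Variable k : nat.
Local Notation n := k.+2.
Implicit Types (f : 'rV[R]_k.+2 -> R) (F : 'rV[R]_k.+2 -> 'rV[R]_k.+2).

(** Pointwise and crude: |u|^2 <= 2(|v|^2 + |u-v|^2) is at most four times the larger square, hence
    the factor 2^n. *)
Lemma hlength_triangle (x u v : 'rV[R]_k.+2) :
  hlength x u ^+ n <= 2 ^+ n * (hlength x v ^+ n + hlength x (u - v) ^+ n).
Proof.
have sq w : hlength x w ^+ 2 = 4 / (1 - enorm x ^+ 2) ^+ 2 * enorm w ^+ 2.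
  rewrite /hlength /hmetric; under eq_bigr do rewrite -expr2; rewrite -enorm_sqr.
  by rewrite sqr_sqrtr// mulr_ge0 ?divr_ge0 ?sqr_ge0.
have h : hlength x u ^+ 2 <= 2 * (hlength x v ^+ 2 + hlength x (u - v) ^+ 2).
  rewrite !sq -mulrDr; set K := 4 / _; have K0 : 0 <= K by rewrite divr_ge0 ?sqr_ge0.
  rewrite [leRHS]mulrCA; apply: ler_wpM2l => //; rewrite !enorm_sqr -big_split/=.
  rewrite mulr_sumr; apply: ler_sum => i _; rewrite !mxE.
  have := sqr_ge0 (2 * v ord0 i - u ord0 i); nra.
have u0 := hlength_ge0 x u; have v0 := hlength_ge0 x v.
have w0 := hlength_ge0 x (u - v).
have hm : hlength x u <= 2 * Num.max (hlength x v) (hlength x (u - v)).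
  rewrite -(@ler_pXn2r _ 2)// ?nnegrE ?mulr_ge0// ?le_max ?v0//.
  apply: (le_trans h); rewrite exprMn.
  set a := hlength x v in v0 *; set b := hlength x (u - v) in w0 *.
  have [ab|/ltW ba] := leP a b.
    have : a ^+ 2 <= b ^+ 2 by rewrite ler_pXn2r.
    by move: (a ^+ 2) (b ^+ 2) => a2 b2; lra.
  have : b ^+ 2 <= a ^+ 2 by rewrite ler_pXn2r.
  by move: (a ^+ 2) (b ^+ 2) => a2 b2; lra.
apply: (@le_trans _ _ ((2 * Num.max (hlength x v) (hlength x (u - v))) ^+ n)).
  by apply: lerXn2r; rewrite ?nnegrE ?mulr_ge0// le_max v0.
rewrite exprMn ler_wpM2l ?exprn_ge0//.
by have [_|_] := leP (hlength x v) (hlength x (u - v)); [rewrite lerDr exprn_ge0|rewrite lerDl exprn_ge0].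
Qed.

Lemma dirichletE f : measurable_fun setT (hgrad f) -> measurable_fun setT (gradnorm f) ->
  (forall x, ~ unit_ball x -> gradnorm f x = 0) ->
  (dirichlet f = \int[hvolume R n]_x (hlength x (hgrad f x) ^+ n)%:E)%E.
Proof.
move=> mF mg g0; rewrite integral_hvolume; first last.
- by move=> x; rewrite lee_fin exprn_ge0// hlength_ge0.
- by apply/measurable_EFinP; apply: measurable_funX; exact: measurable_hlength.
rewrite /dirichlet [RHS]integral_mkcond; apply: eq_integral => x _.
rewrite patchE; case: ifPn => [|xb].
  by rewrite inE => x1; rewrite -EFinM hlength_hgrad_density.
by rewrite g0 ?expr0n// => x1; move: xb; rewrite mem_set.
Qed.

Lemma measurable_hgrad f r : c1_ball f r -> measurable_fun setT (hgrad f).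
Proof.
move=> fr; apply/measurable_fun_rowP => i.
rewrite (_ : (fun _ => _) = fun x => (1 - enorm x ^+ 2) ^+ 2 / 4 * partial i f x); last first.
  by apply/funext => x; rewrite !mxE.
apply: measurable_funM; last exact: (measurable_partial fr).
apply: measurable_funM => //; apply: measurable_funX; apply: measurable_funB => //.
by apply: measurable_funX; exact: measurable_enorm.
Qed.

Lemma sobolev_norm_cvg (E : nat -> \bar R) : (forall j, 0 <= E j)%E ->
  (E j `^ (n%:R^-1) @[j --> \oo] --> 0)%E ->
  forall e : R, 0 < e -> exists N, forall j, (N <= j)%N -> (E j <= e%:E)%E.
Proof.
move=> E0 /fine_cvgP[tfin t0] e e0.
have en : 0 < e `^ (n%:R^-1) by exact: powR_gt0.
have [N1 _ h1] := cvgr_lt _ t0 _ en.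
have [N2 _ h2] := tfin.
exists (maxn N1 N2) => j; rewrite geq_max => /andP[j1 j2].
have := h1 j j1; have := h2 j j2 => /= jf.
rewrite -lte_fin fineK// => /ltW h.
rewrite -[E j]poweRe1// -[e]powRr1 ?(ltW e0)// -(@mulVf _ n%:R)// poweRrM powRrM -poweR_EFin.
apply: gt0_ler_poweR => //; rewrite in_itv/= leey andbT ?poweR_ge0//.
by rewrite lee_fin ltW.
Qed.

Lemma weighted_sobolev_wmass (beta q : R) : 0 <= beta -> beta < n%:R -> n%:R <= q ->
  exists2 C : R, 0 <= C & forall f F, sobolev0 f F ->
    (wmass beta q f <=
     C%:E * (\int[hvolume R n]_x (hlength x (F x) ^+ n)%:E) `^ (q / n%:R))%E.
Proof.
move=> b0 bn nq; have [C C0 hC] := @weighted_c1_homogeneous R k beta q b0 bn nq.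
have q0 : 0 < q by apply: lt_le_trans nq.
have qn0 : 0 < q / n%:R by rewrite divr_gt0.
(* The power of 2 comes from taking e = [j0] in [key], where 2^n (j0 + j0) = 2^(n+1) j0. Adding 1 to
   C makes [C'] positive, which settles infinite energy, and allows a division below. *)
pose C' := (C + 1) * 2 `^ (n.+1%:R * (q / n%:R)).
have C'0 : 0 < C' by rewrite mulr_gt0 ?powR_gt0// ltr_wpDl.
exists C'; first exact: ltW.
move=> f F [mf mF [phi [tphi cvphi]]].
set J := (\int[hvolume R n]_x (hlength x (F x) ^+ n)%:E)%E.
have J0 : (0 <= J)%E by apply: integral_ge0 => x _; rewrite lee_fin exprn_ge0// hlength_ge0.
have [Joo|] := ltP J +oo%E; last first.
  by rewrite leye_eq => /eqP ->; rewrite poweRyr ?gt_eqF// gt0_muley ?leey.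
have Jfin : J \is a fin_num by rewrite ge0_fin_numE.
pose j0 := fine J.
have j00 : 0 <= j0 by exact: fine_ge0.
have c1 j : exists r, c1_ball (phi j) r by exact: test_function_c1.
have mphi j : measurable_fun setT (phi j) by have [r fr] := c1 j; exact: (measurable_c1 fr).
have mh j : measurable_fun setT (hgrad (phi j)).
  by have [r fr] := c1 j; exact: (measurable_hgrad fr).
have mB j : measurable_fun setT (fun x => hgrad (phi j) x - F x).
  apply/measurable_fun_rowP => i.
  rewrite (_ : (fun _ => _) = fun x => hgrad (phi j) x ord0 i - F x ord0 i); last first.
    by apply/funext => x; rewrite !mxE.
  apply: measurable_funB; first by have /measurable_fun_rowP := mh j; exact.
  by have /measurable_fun_rowP := mF; exact.
pose E j := (\int[hvolume R n]_x
  (hlength x (hgrad (phi j) x - F x) ^+ n + `|phi j x - f x| ^+ n)%:E)%E.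
have E0 j : (0 <= E j)%E.
  by apply: integral_ge0 => x _; rewrite lee_fin addr_ge0// exprn_ge0// hlength_ge0.
have mE1 j : measurable_fun setT (fun x => hlength x (hgrad (phi j) x - F x) ^+ n).
  by apply: measurable_funX; exact: measurable_hlength.
have mE2 j : measurable_fun setT (fun x => `|phi j x - f x| ^+ n).
  by apply: measurable_funX; apply: measurableT_comp => //; exact: measurable_funB.
have Ecv := sobolev_norm_cvg E0 cvphi.
have Ephi j : (\int[hvolume R n]_x (`|phi j x - f x| ^+ n)%:E <= E j)%E.
  apply: ge0_le_integral => //.
  - exact/measurable_EFinP.
  - by apply/measurable_EFinP; exact: measurable_funD.
  - by move=> x _; rewrite lee_fin lerDr exprn_ge0// hlength_ge0.
have dirE j : (dirichlet (phi j) <= (2 ^+ n)%:E * (J + E j))%E.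
  have [r fr] := c1 j.
  rewrite (dirichletE (measurable_hgrad fr) (measurable_gradnorm fr)); last first.
    move=> x /(c1_zero fr)[_ p0]; rewrite /gradnorm (_ : egrad _ x = 0).
      by rewrite /enorm big1 ?sqrtr0// => i _; rewrite mxE expr0n.
    by apply/rowP => i; rewrite !mxE.
  rewrite /J /E -ge0_integralD//; first last.
  - by apply/measurable_EFinP; exact: measurable_funD.
  - by move=> x _; rewrite lee_fin addr_ge0// exprn_ge0// hlength_ge0.
  - by apply/measurable_EFinP; apply: measurable_funX; exact: measurable_hlength.
  - by move=> x _; rewrite lee_fin exprn_ge0// hlength_ge0.
  have mS : measurable_fun setT (fun x => ((hlength x (F x) ^+ n)%:E +
      (hlength x (hgrad (phi j) x - F x) ^+ n + `|phi j x - f x| ^+ n)%:E)%E).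
    apply: emeasurable_funD; apply/measurable_EFinP; last exact: measurable_funD.
    by apply: measurable_funX; exact: measurable_hlength.
  have S0 x : (0 <= (hlength x (F x) ^+ n)%:E +
      (hlength x (hgrad (phi j) x - F x) ^+ n + `|phi j x - f x| ^+ n)%:E)%E.
    by rewrite -EFinD lee_fin !addr_ge0// exprn_ge0// hlength_ge0.
  rewrite -ge0_integralZl//.
  apply: ge0_le_integral => //.
  - by move=> x _; rewrite lee_fin exprn_ge0// hlength_ge0.
  - by apply/measurable_EFinP; apply: measurable_funX; exact: measurable_hlength.
  - exact: measurable_funeM.
  move=> x _; rewrite -EFinD -EFinM lee_fin.
  apply: le_trans (hlength_triangle x _ (F x)) _.
  by rewrite ler_wpM2l ?exprn_ge0// addrA lerDl exprn_ge0.
(* The slack e bounds E_j for large j and also keeps the energy bound positive, as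
   [weighted_c1_homogeneous] demands. *)
have key (e : R) : 0 < e ->
    (wmass beta q f <= (C * (2 ^+ n * (j0 + e)) `^ (q / n%:R))%:E)%E.
  move=> e0; rewrite /wmass.
  apply: (@fatou_Lp _ _ _ (hvolume R n) phi f (fun x => (hrho x `^ beta)^-1) q k.+1) => //.
  - exact: measurable_hrho_powRV.
  - by move=> x; rewrite invr_ge0 powR_ge0.
  - move=> e' e'0; have [N hN] := Ecv e' e'0; exists N => j Nj.
    exact: le_trans (Ephi j) (hN j Nj).
  have [N hN] := Ecv e e0; exists N => j Nj.
  have [r fr] := c1 j.
  apply: (hC (phi j) r) => //; first by rewrite mulr_gt0 ?exprn_gt0// ltr_wpDl.
  apply: le_trans (dirE j) _; rewrite [leRHS]EFinM; apply: lee_wpmul2l.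
    by rewrite lee_fin exprn_ge0.
  by rewrite [leRHS]EFinD /j0 fineK//; apply: leeD => //; exact: hN.
rewrite -(fineK Jfin) -/j0 poweR_EFin -EFinM.
have [j0z|j0n] := eqVneq j0 0; last first.
  have j0p : 0 < j0 by rewrite lt0r j0n.
  apply: le_trans (key _ j0p) _; rewrite lee_fin.
  have -> : 2 ^+ n * (j0 + j0) = 2 ^+ n.+1 * j0 by rewrite [2 ^+ n.+1]exprS; ring.
  rewrite powRM ?exprn_ge0// -powR_mulrn// -powRrM mulrA ler_wpM2r ?powR_ge0//.
  by rewrite ler_wpM2r ?powR_ge0// lerDl.
rewrite j0z powR0 ?gt_eqF// mulr0.
apply/lee_addgt0Pr => e e0; rewrite add0e.
(* For zero energy, [key] is used with arbitrarily small slack: [e1] solves (2^n e1)^(q/n) =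
   e/(C+1), so the bound is at most e. *)
pose e1 : R := (e / (C + 1)) `^ (n%:R / q) / 2 ^+ n.
have C1 : 0 < C + 1 by rewrite ltr_wpDl.
have e10 : 0 < e1 by rewrite divr_gt0 ?exprn_gt0// powR_gt0// divr_gt0.
apply: le_trans (key _ e10) _; rewrite j0z add0r lee_fin.
have -> : 2 ^+ n * e1 = (e / (C + 1)) `^ (n%:R / q).
  by rewrite /e1 mulrC divfK// gt_eqF// exprn_gt0.
rewrite -powRrM (_ : n%:R / q * (q / n%:R) = 1); last first.
  by field; rewrite gt_eqF//= gt_eqF.
rewrite powRr1 ?divr_ge0 ?(ltW e0) ?(ltW C1)// mulrCA ler_piMr ?(ltW e0)//.
by rewrite ler_pdivrMr// mul1r lerDl.
Qed.

End completion.

(** * The two inequalities *)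

Section main.
Context {R : realType}.
Variable k : nat.
Local Notation n := k.+2.

Lemma Lnorm_hlength (F : 'rV[R]_k.+2 -> 'rV[R]_k.+2) :
  ('N[hvolume R n]_((n%:R)%:E)[(fun x => (hlength x (F x))%:E)] =
   (\int[hvolume R n]_x (hlength x (F x) ^+ n)%:E) `^ (n%:R^-1))%E.
Proof.
rewrite Lnorm_EFinE; apply: (congr1 (fun z => poweR z n%:R^-1)).
by apply: eq_integral => x _; rewrite powR_mulrn// ger0_norm// hlength_ge0.
Qed.

Lemma norm_weight_powR (beta q : R) (f : 'rV[R]_k.+2 -> R) x : 0 < q ->
  `|f x / hrho x `^ (beta / q)| `^ q = `|f x| `^ q * (hrho x `^ beta)^-1.
Proof.
move=> q0; rewrite normrM normfV (ger0_norm (powR_ge0 _ _)) powRM ?invr_ge0 ?powR_ge0//.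
congr (_ * _); rewrite -[(hrho x `^ (beta / q))^-1]powR_inv1 ?powR_ge0// -!powRrM.
by rewrite mulN1r mulrN divfK ?gt_eqF// powRN.
Qed.

Lemma weighted_sobolev_exists (beta q : R) : 0 <= beta -> beta < n%:R -> n%:R <= q ->
  exists C2 : R, 0 < C2 /\ @weighted_sobolev R k.+2 beta q C2.
Proof.
move=> b0 bn nq; have q0 : 0 < q by apply: lt_le_trans nq.
have [C C0 hC] := @weighted_sobolev_wmass R k beta q b0 bn nq.
pose D := (C + 1) `^ (q^-1).
have D0 : 0 < D by rewrite powR_gt0// ltr_wpDl.
have qp : 0 < q `^ (1 - n%:R^-1) by rewrite powR_gt0.
(* Dividing by the power of q cancels the factor written in [weighted_sobolev]; [D] uses C+1 to be
   positive. *)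
exists (D / q `^ (1 - n%:R^-1)); split; first by rewrite divr_gt0.
move=> f F fF; rewrite divfK ?gt_eqF// Lnorm_hlength Lnorm_EFinE.
set J := (\int[_]_x (hlength x (F x) ^+ n)%:E)%E.
have J0 : (0 <= J)%E by apply: integral_ge0 => x _; rewrite lee_fin exprn_ge0// hlength_ge0.
under eq_integral do rewrite norm_weight_powR//.
apply: (@le_trans _ _ (((C + 1)%:E * J `^ (q / n%:R)) `^ q^-1)%E); last first.
  rewrite poweRM ?lee_fin ?addr_ge0// ?poweR_ge0// poweR_EFin -poweRrM.
  by rewrite mulrAC divff ?gt_eqF// mul1r.
apply: gt0_ler_poweR; first by rewrite invr_ge0 ltW.
- rewrite in_itv/= leey andbT; apply: integral_ge0 => x _.
  by rewrite lee_fin mulr_ge0 ?invr_ge0 ?powR_ge0.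
- by rewrite in_itv/= leey andbT mule_ge0 ?poweR_ge0// lee_fin addr_ge0.
apply: le_trans (hC f F fF) _; apply: lee_wpmul2r; first exact: poweR_ge0.
by rewrite lee_fin lerDl.
Qed.

Lemma weighted_uncertainty (beta q q' C2 : R) :
  0 <= beta -> beta < n%:R -> n%:R <= q -> 1 / q + 1 / q' = 1 ->
  0 < C2 -> @weighted_sobolev R k.+2 beta q C2 ->
  forall (f : 'rV[R]_k.+2 -> R) (F : 'rV[R]_k.+2 -> 'rV[R]_k.+2), sobolev0 f F ->
  ((C2^-1 * q `^ (n%:R^-1 - 1))%:E *
     \int[hvolume R n]_x (hrho x `^ ((q - beta) / q) * `|f x| ^+ 2)%:E <=
   (\int[hvolume R n]_x (hlength x (F x) ^+ n)%:E) `^ (n%:R^-1) *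
   (\int[hvolume R n]_x (hrho x `^ q' * `|f x| `^ q')%:E) `^ (q'^-1))%E.
Proof.
move=> b0 bn nq qq' C20 hC2 f F fF; have [mf _ _] := fF.
have q1 : 1 < q by apply: lt_le_trans nq; rewrite ltr1n.
have q0 : 0 < q by exact: lt_trans q1.
have qV1 : q^-1 < 1 by rewrite invf_lt1.
have q'V : q'^-1 = 1 - q^-1 by move: qq'; rewrite !div1r; lra.
have q'0 : 0 < q' by rewrite -invr_gt0 q'V subr_gt0.
have mnf : measurable_fun setT (fun x => `|f x|) by exact: measurableT_comp.
have mrho := @measurable_hrho R n.
pose u (x : 'rV[R]_k.+2) := `|f x / hrho x `^ (beta / q)|.
pose v (x : 'rV[R]_k.+2) := hrho x * `|f x|.
have u0 x : 0 <= u x by exact: normr_ge0.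
have v0 x : 0 <= v x by rewrite mulr_ge0// hrho_ge0.
have mu_ : measurable_fun setT u.
  apply: measurableT_comp => //; apply: measurable_funM => //.
  exact: measurable_hrho_powRV.
have mv : measurable_fun setT v by exact: measurable_funM.
have uv x : hrho x `^ ((q - beta) / q) * `|f x| ^+ 2 = u x * v x.
  rewrite /u /v normrM normfV (ger0_norm (powR_ge0 _ _)).
  (* Where [hrho] vanishes, as at the origin, both sides are 0: the exponent (q-beta)/q is positive
     because beta < n <= q, and [v x] contains the factor [hrho x]. *)
  have [r0|rn0] := eqVneq (hrho x) 0.
    by rewrite r0 powR0 ?mul0r ?mulr0// gt_eqF// divr_gt0// subr_gt0 (lt_le_trans bn).
  rewrite mulrBl divff ?gt_eqF// powRB ?rn0 ?implybT// powRr1 ?hrho_ge0//; ring.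
have -> : (\int[hvolume R n]_x (hrho x `^ ((q - beta) / q) * `|f x| ^+ 2)%:E =
    \int[hvolume R n]_x (u x * v x)%:E)%E.
  by apply: eq_integral => x _; rewrite uv.
have -> : (\int[hvolume R n]_x (hrho x `^ q' * `|f x| `^ q')%:E =
    \int[hvolume R n]_x (v x `^ q')%:E)%E.
  by apply: eq_integral => x _; rewrite /v powRM// hrho_ge0.
have conj : q^-1 + q'^-1 = 1 by rewrite q'V addrC subrK.
have hol := hoelder_ge0 (hvolume R n) mu_ mv u0 v0 q0 q'0 conj.
have := hC2 f F fF; rewrite Lnorm_hlength Lnorm_EFinE -/u.
set U := (\int[_]_x (u x `^ q)%:E)%E in hol *.
set K := (_ `^ (q'^-1))%E in hol *.
set J := (_ `^ (n%:R^-1))%E.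
move=> sob.
have K0 : (0 <= K)%E by exact: poweR_ge0.
(* [c] is the inverse of the constant C2 q^(1-1/n) of the weighted inequality, so the two cancel
   once it is inserted into Hölder's bound. *)
pose c := C2^-1 * q `^ (n%:R^-1 - 1).
have c0 : 0 <= c by rewrite mulr_ge0 ?invr_ge0 ?powR_ge0// ltW.
rewrite -/c; apply: (@le_trans _ _ (c%:E * ((C2 * q `^ (1 - n%:R^-1))%:E * J * K))%E).
  apply: lee_wpmul2l; first by rewrite lee_fin.
  by apply: le_trans hol _; apply: lee_wpmul2r.
rewrite !muleA -EFinM (_ : c * _ = 1) ?mul1e//.
rewrite /c mulrACA mulVf ?gt_eqF// mul1r -powRD; last first.
  by rewrite (gt_eqF q0) implybT.
by rewrite (_ : _ + _ = 0) ?powRr0//; ring.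
Qed.

End main.
Unset Implicit Arguments.

Theorem theorem4p4 (R : realType) (n : nat) (beta q q' : R)
    (n_ge2 : (2 <= n)%N) (beta_ge0 : 0 <= beta) (beta_lt : beta < n%:R)
    (q_ge : n%:R <= q) (qq' : 1 / q + 1 / q' = 1) :
  (exists C2 : R, 0 < C2 /\ weighted_sobolev n beta q C2) /\
  (forall C2 : R, 0 < C2 -> weighted_sobolev n beta q C2 ->
   forall (f : 'rV[R]_n -> R) (F : 'rV[R]_n -> 'rV[R]_n), sobolev0 f F ->
   ((C2^-1 * q `^ (n%:R^-1 - 1))%:E *
      \int[hvolume R n]_x (hrho x `^ ((q - beta) / q) * `|f x| ^+ 2)%:E <=
    (\int[hvolume R n]_x (hlength x (F x) ^+ n)%:E) `^ (n%:R^-1) *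
    (\int[hvolume R n]_x (hrho x `^ q' * `|f x| `^ q')%:E) `^ (q'^-1))%E).
Proof.
case: n n_ge2 beta_lt q_ge => [//|[//|k]] _ bn nq; split.
  exact: weighted_sobolev_exists.
by move=> C2 C20 hC2; exact: weighted_uncertainty.
Qed.
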